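(* Let $(a_n)_{n<0}$ be a sequence in $\mathbb{Z}((q))$ satisfying the lower bound condition. Define the inverted Habiro series \[ P(x)=\sum_{k\ge0}a_{-k-1}\,\tilde\sigma_{-k-1},\qquad \tilde\sigma_{-k-1}=\frac{(-1)^k q^{\binom{k+1}{2}}}{(x;q)_{k+1}(qx^{-1};q)_k}, \] and coefficients $f_i=\sum_{k=0}^{i}\begin{bmatrix} k+i\\ 2k\end{bmatrix}a_{-k-1}$ for $i\ge 0$. Then, as an identity of $q$-series (each term expanded at $q=0$, with coefficients rational functions of $x$), both sides converge and \[ P(x)=\frac{1}{(q,x,qx^{-1};q)_\infty}\sum_{i\ge0}f_i\,\theta_i(x), \qquad \theta_i(x)=(-1)^iq^{\binom{i+1}{2}}\Big(1+\sum_{n=1}^{\infty}(-1)^nq^{\binom{n+1}{2}+ni}(x^n+x^{-n})\Big). \]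
   Context: Let $v$ be an indeterminate, $q=v^2$; $[n]=\frac{v^n-v^{-n}}{v-v^{-1}}$, $[k]!=[k]\cdots[1]$, $\begin{bmatrix} n\\ k\end{bmatrix}=\frac{[n]\cdots[n-k+1]}{[k]!}$. $q$-Pochhammer symbols: $(a;q)_n=\prod_{j=0}^{n-1}(1-aq^j)$ for $n\in\mathbb{Z}_{\ge0}\cup\{\infty\}$, and $(a_1,\dots,a_r;q)_n=\prod_s(a_s;q)_n$. For $f\in\mathbb{Z}((q))$, $\delta(f)$ is the minimal exponent of $q$ in $f$. A sequence $(a_n)_{n<0}$ satisfies the lower bound condition if there is a constant $C$ with $\delta(a_n)\ge-\frac{n(n+3)}{2}+C$ for all $n<0$. Note $(q,x,qx^{-1};q)_\infty$ equals the Jacobi theta function $\theta(x,q)=\sum_{n\in\mathbb{Z}}(-1)^nx^nq^{n(n-1)/2}$. *)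

(* Defs.v *)
(* Formal Laurent series in the variable v (q = v^2) with
   coefficients in K = Q(x) = {fraction {poly rat}}. *)
From HB Require Import structures.
From mathcomp Require Import all_boot all_order all_algebra.
From Stdlib Require Import ClassicalEpsilon.
Set Implicit Arguments. Unset Strict Implicit. Unset Printing Implicit Defensive.
Import Order.TTheory GRing.Theory Num.Theory.
Local Open Scope ring_scope.

(* A formal Laurent series  v^s * (sum_{j>=0} c_j v^j)  (or q^s * ... for
   series in q).  Different representations of the same series are compared
   coefficientwise via [lequiv]. *)
Record lser (R : Type) := LSer { lshift : int; lps : nat -> R }.

Definition coef (R : zmodType) (f : lser R) (n : int) : R :=
  match (n - lshift f)%R with Posz m => lps f m | Negz _ => 0 end.

Definition lequiv (R : zmodType) (f g : lser R) := forall n, coef f n = coef g n.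

Definition delta_ge (R : zmodType) (f : lser R) (b : int) :=
  forall e : int, e < b -> coef f e = 0.

Definition K := {fraction {poly rat}}.
Definition xK : K := @FracField.tofrac _ ('X : {poly rat}).

Definition lmono (c : K) (e : int) : lser K :=
  LSer e (fun j => if j == 0%N then c else 0).
Definition lzero : lser K := lmono 0 0.
Definition lone : lser K := lmono 1 0.

Definition ladd (f g : lser K) : lser K :=
  let m := Order.min (lshift f) (lshift g) in
  LSer m (fun j => coef f (m + j%:Z) + coef g (m + j%:Z)).
Definition lopp (f : lser K) : lser K := LSer (lshift f) (fun j => - lps f j).
Definition lmul (f g : lser K) : lser K :=
  LSer (lshift f + lshift g) (fun n => \sum_(i < n.+1) lps f i * lps g (n - i)).

Definition lsum_fin (s : nat -> lser K) (m : nat) : lser K :=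
  foldr (fun j acc => ladd (s j) acc) lzero (iota 0 m).
Definition lprod_fin (s : nat -> lser K) (m : nat) : lser K :=
  foldr (fun j acc => lmul (s j) acc) lone (iota 0 m).

Definition has_lim (s : nat -> lser K) (L : lser K) :=
  forall N : int, exists M0 : nat, forall M, (M0 <= M)%N ->
    forall n : int, n < N -> coef (s M) n = coef L n.
Definition has_sum (s : nat -> lser K) (S : lser K) := has_lim (lsum_fin s) S.

Definition inh_lser : inhabited (lser K) := inhabits lzero.
Definition llim (s : nat -> lser K) : lser K := epsilon inh_lser (has_lim s).
Definition lsum (s : nat -> lser K) : lser K := epsilon inh_lser (has_sum s).
Definition linv (f : lser K) : lser K :=
  epsilon inh_lser (fun g => lequiv (lmul f g) lone).

(* embedding Z((q)) -> K((v)), q |-> v^2 *)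
Definition emb (f : lser int) : lser K :=
  LSer (2 * lshift f) (fun j => if odd j then 0 else (lps f j./2)%:~R).

Definition vpow (e : int) : lser K := lmono 1 e.
Definition qpow (e : int) : lser K := lmono 1 (2 * e).

Definition qint (m : nat) : lser K :=
  lmul (ladd (vpow m%:Z) (lopp (vpow (- m%:Z))))
       (linv (ladd (vpow 1) (lopp (vpow (-1))))).
Definition qbinom (n k : nat) : lser K :=
  lmul (lprod_fin (fun j => qint (n - j)) k)
       (linv (lprod_fin (fun j => qint j.+1) k)).

Definition qpoch (a : lser K) (m : nat) : lser K :=
  lprod_fin (fun j => ladd lone (lopp (lmul a (qpow j%:Z)))) m.
Definition qpoch_inf (a : lser K) : lser K := llim (qpoch a).

Definition xS : lser K := lmono xK 0.
Definition qxinvS : lser K := lmono xK^-1 2.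
Definition qS : lser K := qpow 1.

Definition theta_prod : lser K :=
  lmul (lmul (qpoch_inf qS) (qpoch_inf xS)) (qpoch_inf qxinvS).

Definition lower_bound_condition (a : int -> lser int) :=
  exists C : int, forall n : int, n < 0 ->
    delta_ge (a n) (- divz (n * (n + 3)) 2 + C).

Definition sigt (k : nat) : lser K :=
  lmul (lmono ((-1) ^+ k) (2 * ('C(k.+1, 2))%:Z))
       (linv (lmul (qpoch xS k.+1) (qpoch qxinvS k))).

Definition aneg (a : int -> lser int) (k : nat) : lser K := emb (a (- (k.+1)%:Z)).

Definition P_term (a : int -> lser int) (k : nat) : lser K :=
  lmul (aneg a k) (sigt k).

Definition fcoef (a : int -> lser int) (i : nat) : lser K :=
  lsum_fin (fun k => lmul (qbinom (k + i) (2 * k)) (aneg a k)) i.+1.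

Definition theta_term (i n' : nat) : lser K :=
  let n := n'.+1 in
  lmono ((-1) ^+ n * (xK ^+ n + xK ^- n)) (2 * ('C(n.+1, 2) + n * i)%N%:Z).

Definition theta (i : nat) : lser K :=
  lmul (lmono ((-1) ^+ i) (2 * ('C(i.+1, 2))%:Z))
       (ladd lone (lsum (theta_term i))).

Definition R_term (a : int -> lser int) (i : nat) : lser K :=
  lmul (fcoef a i) (theta i).

(* Main.v *)
(* Write c(k,i) = [k+i choose 2k], g_i = (-1)^i q^(i(i+1)/2), T = (q, x, q/x; q)_oo and s_k for the
   rational function attached to a_(-k-1), so that theta_i = g_i + sum_(n>=1) g_(i+n) (x^n + x^-n).
   Exchanging summations, the identity reduces to R_k := sum_i c(k,i) theta_i = T s_k for each k.
   Both s_k and R_k satisfy u_k = (x + 1/x - q^(k+1) - q^-(k+1)) u_(k+1): for s_k this is immediate, and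
   for R_k it follows from the recurrence of c(k,i) in i together with
   (x + 1/x) theta_i = theta_(i+1) + theta_(i-1) - (g_(i-1) - g_(i+1)),
   because sum_i c(k,i) (g_(i-1) - g_(i+1)) = 0 for k >= 1 by telescoping.
   Hence R_k / s_k does not depend on k.  As k -> oo, R_k / g_k tends to
   sum_j (-1)^j q^(j(j+1)/2) / (q;q)_j = (q;q)_oo (Euler), so the constant ratio is T. *)

(* The series of the statement are representations compared coefficientwise, with limits and
   inverses chosen by [epsilon], so field laws do not hold for them as equalities. The argument
   therefore runs in an abstract field with a complete valuation, and [lau_of] transports it to the
   series through the fraction field of power series over [K]. Convergence is the delicate point: in
   powers of v, c(k,i) may have a pole of order 2k(i - k) and a_(-k-1) one of order about k^2,
   against the zero of order i(i+1) of theta_i. These quadratic forms add up to a square (i - k)^2,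
   and only the linear remainder i + k makes the double sum converge along the diagonal. Each
   recurrence is first proved for truncated sums with explicit boundary terms, which vanish in the
   limit because a single index squared dominates linear losses. *)
From HB Require Import structures.
From mathcomp Require Import all_boot all_order all_algebra.
From mathcomp Require Import boolp.
From mathcomp Require Import ring lra zify.
From Stdlib Require Import ClassicalEpsilon.
Require Import Defs.
Set Implicit Arguments. Unset Strict Implicit. Unset Printing Implicit Defensive.
Import Order.TTheory GRing.Theory Num.Theory.
Local Open Scope ring_scope.

(* [O] plays the role of a complete discrete valuation ring with uniformizer [v] and fraction field [F];
   [vge v O N z] says that [z] has valuation at least [N]. *)
Definition vge (F : fieldType) (v : F) (O : F -> Prop) (N : int) (z : F) :=
  O (z * v ^ (- N)).

Definition tends (F : fieldType) (v : F) (O : F -> Prop) (s : nat -> F) (L : F) :=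
  forall N : int, exists M0 : nat, forall M, (M0 <= M)%N -> vge v O N (s M - L).

(** Completeness asks only that consecutive differences tend to 0: for a non-archimedean valuation
    this is already the Cauchy condition. *)
Record complete_valuation_ring (F : fieldType) (v : F) (O : F -> Prop) : Prop := {
  vr_v0 : v != 0;
  vr_1 : O 1;
  vr_v : O v;
  vr_sub : forall z w, O z -> O w -> O (z - w);
  vr_mul : forall z w, O z -> O w -> O (z * w);
  vr_inv : forall z, O z -> O (1 + v * z)^-1;
  vr_sep : forall z, (forall n : nat, O (z * v ^- n)) -> z = 0;
  vr_exh : forall z, exists n : nat, O (z * v ^+ n);
  vr_complete : forall s : nat -> F,
    (forall N : int, exists M0 : nat, forall M, (M0 <= M)%N ->
       vge v O N (s M.+1 - s M)) ->
    exists L, tends v O s L }.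

(** * Analysis in a complete valued field *)

Section Valued.
Variables (F : fieldType) (v : F) (O : F -> Prop).
Hypothesis hO : complete_valuation_ring v O.
Local Notation vge := (vge v O).
Local Notation tends := (tends v O).

Let v0 := vr_v0 hO.
Let vD (m n : int) : v ^ (m + n) = v ^ m * v ^ n.
Proof. exact: expfzDr. Qed.

Lemma vge_B N z w : vge N z -> vge N w -> vge N (z - w).
Proof. by rewrite /vge mulrBl; apply: (vr_sub hO). Qed.

Lemma vge_0 N : vge N 0.
Proof. by rewrite /vge mul0r -(subrr 1); apply: (vr_sub hO); apply: (vr_1 hO). Qed.

Lemma vge_N N z : vge N z -> vge N (- z).
Proof. by move=> h; rewrite -sub0r; apply: vge_B => //; apply: vge_0. Qed.

Lemma vge_D N z w : vge N z -> vge N w -> vge N (z + w).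
Proof. by move=> h h'; rewrite -[w]opprK; apply: vge_B => //; apply: vge_N. Qed.

Lemma vge_M a b z w : vge a z -> vge b w -> vge (a + b) (z * w).
Proof.
rewrite /vge opprD vD mulrACA; exact: (vr_mul hO).
Qed.

Lemma vge_vX n : vge 0 (v ^+ n).
Proof.
rewrite /vge oppr0 expr0z mulr1; elim: n => [|n IH]; first exact: (vr_1 hO).
by rewrite exprS; apply: (vr_mul hO) => //; apply: (vr_v hO).
Qed.

Lemma vge_le a b z : vge a z -> (b <= a)%R -> vge b z.
Proof.
move=> h ab; have [n ->] : exists n : nat, b = a - n%:Z by exists `|a - b|%N; lia.
have := vge_vX n; rewrite /vge oppr0 expr0z mulr1 opprB => h2.
by rewrite addrC vD mulrA; apply: (vr_mul hO).
Qed.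

Lemma vge_v e : vge e (v ^ e).
Proof. by rewrite /vge -vD subrr expr0z; apply: (vr_1 hO). Qed.

Lemma vge_1 : vge 0 1.
Proof. by have := vge_v 0; rewrite expr0z. Qed.

Lemma vge_sum N (I : Type) (r : seq I) (P : pred I) (s : I -> F) :
  (forall i, P i -> vge N (s i)) -> vge N (\sum_(i <- r | P i) s i).
Proof. by move=> h; elim/big_ind: _ => //; [apply: vge_0|apply: vge_D]. Qed.

Lemma vge_sep z : (forall N : int, vge N z) -> z = 0.
Proof. by move=> h; apply: (vr_sep hO) => n; have := h n; rewrite /vge exprnN. Qed.

Lemma vge_exh z : exists N, vge N z.
Proof.
by have [n h] := vr_exh hO z; exists (- n%:Z); rewrite /vge opprK.
Qed.

Lemma vge_inv1 z : vge 1 (z - 1) -> vge 0 z^-1.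
Proof.
rewrite /vge => h; rewrite oppr0 expr0z mulr1.
have := vr_inv hO h; rewrite [v * _]mulrCA -[X in X * v ^ _]expr1z -vD subrr expr0z mulr1.
by rewrite addrC subrK.
Qed.

(** If [z = 0], then [v^-1] lies in [O], hence so do all its powers, and separatedness forces
    [1 = 0]. *)
Lemma vge_neq0 z : vge 1 (z - 1) -> z != 0.
Proof.
move=> h; apply/eqP => z0; move: h; rewrite z0 sub0r => /vge_N; rewrite opprK => h.
suff /eqP: 1 = 0 :> F by rewrite oner_eq0.
apply: (vr_sep hO); elim=> [|n IH]; first by rewrite expr0 invr1 mulr1; exact: (vr_1 hO).
by rewrite mul1r exprS invfM -[v^-1]mul1r; apply: (vr_mul hO) => //; rewrite -[v ^- n]mul1r.
Qed.

Lemma tends_const L : tends (fun=> L) L.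
Proof. by move=> N; exists 0%N => M _; rewrite subrr; apply: vge_0. Qed.

Lemma tends_ext s t L : s =1 t -> tends s L -> tends t L.
Proof. by move=> e h N; have [M0 h0] := h N; exists M0 => M; rewrite -e; apply: h0. Qed.

Lemma tendsB s t L L' : tends s L -> tends t L' -> tends (fun M => s M - t M) (L - L').
Proof.
move=> h h' N; have [A hA] := h N; have [B hB] := h' N.
exists (maxn A B) => M; rewrite geq_max => /andP[/hA a /hB b].
have -> : s M - t M - (L - L') = (s M - L) - (t M - L') by ring.
exact: vge_B.
Qed.

Lemma tends_vge N s L :
  tends s L -> (exists M1, forall M, (M1 <= M)%N -> vge N (s M)) -> vge N L.
Proof.
move=> h [M1 h1]; have [M0 h0] := h N.
have -> : L = s (maxn M0 M1) - (s (maxn M0 M1) - L) by ring.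
by apply: vge_B; [apply/h1/leq_maxr|apply/h0/leq_maxl].
Qed.

Lemma tends_uniq s L L' : tends s L -> tends s L' -> L = L'.
Proof.
move=> h h'; apply/eqP; rewrite -subr_eq0; apply/eqP/vge_sep => N.
apply: (tends_vge (tendsB h h')); exists 0%N => M _.
by rewrite subrr; apply: vge_0.
Qed.

Lemma tends0P s :
  tends s 0 <-> forall N : int, exists M0 : nat, forall M, (M0 <= M)%N -> vge N (s M).
Proof.
by split=> h N; have [M0 h0] := h N; exists M0 => M /h0; rewrite subr0.
Qed.

Lemma tendsD s t L L' : tends s L -> tends t L' -> tends (fun M => s M + t M) (L + L').
Proof.
move=> h h'; have := tendsB h (tendsB (tends_const 0) h'); rewrite sub0r opprK.
by apply: tends_ext => M; rewrite sub0r opprK.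
Qed.

Lemma tendsM s t L L' : tends s L -> tends t L' -> tends (fun M => s M * t M) (L * L').
Proof.
move=> h h' N; have [a ha] := vge_exh L; have [b hb] := vge_exh L'.
(* The bound [a] in the maximum lets [s M] inherit the valuation bound of [L]. *)
have [A hA] := h (Order.max (N - b) a); have [B hB] := h' (N - a).
exists (maxn A B) => M; rewrite geq_max => /andP[/hA e /hB f].
have e1 : vge (N - b) (s M - L) by apply: vge_le e _; rewrite le_max lexx.
have e2 : vge a (s M).
  rewrite -[s M](subrK L); apply: vge_D => //; apply: vge_le e _.
  by rewrite le_max lexx orbT.
have -> : s M * t M - L * L' = s M * (t M - L') + (s M - L) * L' by ring.
apply: vge_D; first by have := vge_M e2 f; rewrite addrC subrK.
by have := vge_M e1 hb; rewrite subrK.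
Qed.

Lemma tends_shift k s L : tends s L -> tends (fun M => s (M + k)%N) L.
Proof.
move=> h N; have [M0 h0] := h N; exists M0 => M hM; apply: h0.
by rewrite (leq_trans hM) ?leq_addr.
Qed.

Lemma vge_vnat n : vge n%:Z (v ^+ n).
Proof. exact: vge_v. Qed.

Lemma series_cvg (u : nat -> F) : tends u 0 ->
  exists L, tends (fun M => \sum_(j < M) u j) L.
Proof.
move=> /tends0P h; apply: (vr_complete hO) => N; have [M0 h0] := h N.
by exists M0 => M /h0; rewrite big_ord_recr /= addrAC subrr add0r.
Qed.

Lemma series_tail (u : nat -> F) L N M0 : tends (fun M => \sum_(j < M) u j) L ->
  (forall j, (M0 <= j)%N -> vge N (u j)) -> vge N (L - \sum_(j < M0) u j).
Proof.
move=> h hu; apply: (tends_vge (tendsB h (tends_const _))).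
exists M0 => M /subnKC <-; elim: (M - M0)%N => [|n IH]; first by rewrite addn0 subrr; apply: vge_0.
by rewrite addnS big_ord_recr /= addrAC; apply: vge_D => //; apply: hu; rewrite leq_addr.
Qed.

Lemma series_vge (u : nat -> F) L N : tends (fun M => \sum_(j < M) u j) L ->
  (forall j, vge N (u j)) -> vge N L.
Proof. by move=> h hu; have := series_tail (M0 := 0) h (fun j _ => hu j); rewrite big_ord0 subr0. Qed.

(* [(a; q)_M] with [q = v ^+ 2]. *)
Definition qprod (a : F) (M : nat) : F := \prod_(j < M) (1 - a * v ^+ (2 * j)).

Lemma qprodS a M : qprod a M.+1 = qprod a M * (1 - a * v ^+ (2 * M)).
Proof. by rewrite /qprod big_ord_recr. Qed.

Lemma vge_qprod a M : vge 0 a -> vge 0 (qprod a M).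
Proof.
move=> ha; elim: M => [|M IH]; first by rewrite /qprod big_ord0; apply: vge_1.
rewrite qprodS; have := vge_M IH (vge_B vge_1 (vge_M ha (vge_vX (2 * M)))).
by rewrite !addr0.
Qed.

Lemma qprod_cvg a : vge 0 a -> exists L, tends (qprod a) L.
Proof.
move=> ha; apply: (vr_complete hO) => N; exists `|N|%N => M hM.
rewrite qprodS; have -> : qprod a M * (1 - a * v ^+ (2 * M)) - qprod a M = - (qprod a M * (a * v ^+ (2 * M))) by ring.
apply: vge_N; apply: vge_le (vge_M (vge_qprod M ha) (vge_M ha (vge_vnat _))) _; lia.
Qed.

(** Every factor except the one at [j = 0] is 1 modulo [v]. Since [a] is merely integral, this
    covers [a = x], where the product need not be 1 modulo [v]. *)
Lemma qprod_head a M : vge 0 a -> vge 1 (qprod a M.+1 - (1 - a)).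
Proof.
move=> ha; elim: M => [|M IH]; first by rewrite /qprod big_ord1 muln0 expr0 mulr1 subrr; apply: vge_0.
rewrite qprodS; set t := _ ^+ _.
have -> : qprod a M.+1 * (1 - a * t) - (1 - a) = (qprod a M.+1 - (1 - a)) - qprod a M.+1 * (a * t) by ring.
apply: vge_B => //; apply: vge_le (vge_M (vge_qprod _ ha) (vge_M ha (vge_vnat _))) _; lia.
Qed.

Lemma qprod_inf_head a L : vge 0 a -> tends (qprod a) L -> vge 1 (L - (1 - a)).
Proof.
move=> ha h; apply: (tends_vge (tendsB h (tends_const _))).
by exists 1%N => -[|M] // _; apply: qprod_head.
Qed.

Lemma qprod_unit a M : vge 1 a -> qprod a M != 0 /\ vge 0 (qprod a M)^-1.
Proof.
move=> ha; elim: M => [|M [IH1 IH2]].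
  by rewrite /qprod big_ord0 invr1 oner_eq0; split=> //; apply: vge_1.
have h : vge 1 (1 - a * v ^+ (2 * M) - 1).
  rewrite addrAC subrr sub0r; apply: vge_N.
  by have := vge_M ha (vge_vX (2 * M)); rewrite addr0.
rewrite qprodS mulf_neq0 ?(vge_neq0 h) //; split=> //.
by rewrite invfM; have := vge_M IH2 (vge_inv1 h); rewrite addr0.
Qed.

(** * Quantum integers and the binomials [k+i choose 2k] *)

Definition qbracket (n : int) : F := (v ^ n - v ^ (- n)) / (v - v ^ (- 1)).

Lemma v2_neq1 n : (0 < n)%N -> 1 - v ^+ (2 * n) != 0.
Proof.
move=> n0; apply: vge_neq0; rewrite addrAC subrr sub0r; apply: vge_N.
apply: vge_le (vge_vnat _) _; lia.
Qed.

Lemma vge_v2 n : (0 < n)%N -> vge 0 (1 - v ^+ (2 * n))^-1.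
Proof.
move=> n0; apply: vge_inv1; rewrite addrAC subrr sub0r; apply: vge_N.
apply: vge_le (vge_vnat _) _; lia.
Qed.

Lemma vz_neq0 (n : int) : v ^ n != 0.
Proof. exact: expfz_neq0. Qed.

Lemma v2_sub1_neq0 : v * v - 1 != 0.
Proof. by have := v2_neq1 (isT : (0 < 1)%N); rewrite muln1 -opprB oppr_eq0 expr2. Qed.

(** Splits off the power of [v] that carries the valuation; for [n > 0] the other factor is a unit
    of [O]. *)
Lemma qbracketE (n : nat) : qbracket n = v ^ (1 - n%:Z) * ((1 - v ^+ (2 * n)) / (1 - v ^+ 2)).
Proof.
have := v2_neq1 (isT : (0 < 1)%N); rewrite muln1 => h.
rewrite /qbracket vD mul2n -addnn exprD -exprnN expr1z -exprnN expr1.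
have := vz_neq0 n; rewrite -exprnP; move: (v ^+ n) => V V0.
by field; rewrite h V0 v0 v2_sub1_neq0.
Qed.

Lemma qbracket_neq0 n : (0 < n)%N -> qbracket n != 0.
Proof.
move=> n0; rewrite qbracketE mulf_neq0 ?vz_neq0 // mulf_neq0 ?v2_neq1 //.
by rewrite invr_eq0 (v2_neq1 (isT : (0 < 1)%N)).
Qed.

Lemma vge_qbracket (n : nat) : vge (1 - n%:Z) (qbracket n).
Proof.
rewrite qbracketE -[X in vge X]addr0; apply: vge_M; first exact: vge_v.
rewrite -[X in vge X]addr0; apply: vge_M; last exact: (vge_v2 (isT : (0 < 1)%N)).
by apply: vge_B; [apply: vge_1|apply: vge_vX].
Qed.

Lemma vge_qbracketV (n : nat) : (0 < n)%N -> vge (n%:Z - 1) (qbracket n)^-1.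
Proof.
move=> n0; rewrite qbracketE !invfM invrK -[v ^ (1 - _) as X in X^-1]invrK ?invrK.
rewrite invr_expz opprB -[X in vge X]addr0; apply: vge_M; first exact: vge_v.
rewrite -[X in vge X]addr0; apply: vge_M; first exact: (vge_v2 n0).
by apply: vge_B; [apply: vge_1|apply: (vge_vX 2)].
Qed.

(* [k + i choose 2k], extended to all integers [i]. *)
Definition qbin (k : nat) (i : int) : F :=
  \prod_(j < k) (qbracket (i + j%:Z + 1) * qbracket (i - j%:Z) /
                 (qbracket (2 * j + 1)%N * qbracket (2 * j + 2)%N)).

Lemma qbin0 i : qbin 0 i = 1.
Proof. by rewrite /qbin big_ord0. Qed.

Lemma qbinS k i : qbin k.+1 i = qbin k i * (qbracket (i + k%:Z + 1) * qbracket (i - k%:Z) /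
                 (qbracket (2 * k + 1)%N * qbracket (2 * k + 2)%N)).
Proof. by rewrite /qbin big_ord_recr. Qed.

Lemma qbracket0 : qbracket 0 = 0.
Proof. by rewrite /qbracket oppr0 subrr mul0r. Qed.

Lemma qbin_eq0 (k i : nat) : (i < k)%N -> qbin k i = 0.
Proof.
elim: k => // k IH; rewrite ltnS leq_eqVlt qbinS => /orP[/eqP->|/IH->]; last by rewrite mul0r.
by rewrite subrr qbracket0 mulr0 mul0r mulr0.
Qed.

Lemma qbin_m1 k : qbin k.+1 (-1) = 0.
Proof.
elim: k => [|k IH]; rewrite qbinS; last by rewrite IH mul0r.
by rewrite (_ : -1 + _ + 1 = 0) // qbracket0 !mul0r mulr0.
Qed.

(** The quotient of neighbouring binomials, cross-multiplied because the bracket on the left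
    vanishes at [i = k - 1]. The other relations between values of [qbin k] are reduced to this
    one. *)
Lemma qbin_shift k i : qbin k (i + 1) * qbracket (i - k%:Z + 1) = qbin k i * qbracket (i + k%:Z + 1).
Proof.
elim: k => [|k IH]; first by rewrite !qbin0 !mul1r; congr qbracket; lia.
rewrite !qbinS.
have e : i + 1 - k%:Z = i - k%:Z + 1 by ring.
have -> : qbin k (i + 1) * (qbracket (i + 1 + k%:Z + 1) * qbracket (i + 1 - k%:Z) /
   (qbracket (2 * k + 1)%N * qbracket (2 * k + 2)%N)) * qbracket (i - k.+1%:Z + 1) =
   (qbin k (i + 1) * qbracket (i - k%:Z + 1)) * (qbracket (i + 1 + k%:Z + 1)) * qbracket (i - k.+1%:Z + 1) /
   (qbracket (2 * k + 1)%N * qbracket (2 * k + 2)%N) by rewrite e; ring.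
rewrite IH.
have -> : i - k.+1%:Z + 1 = i - k%:Z by rewrite -addn1 PoszD; ring.
have -> : i + k.+1%:Z + 1 = i + 1 + k%:Z + 1 by rewrite -addn1 PoszD; ring.
by ring.
Qed.

(** Dual to the recurrence of theta_i: summation by parts turns multiplication by x + 1/x into the
    shifts [i + 1] and [i - 1] of the binomial. *)
Lemma qbin_rec k i : qbin k.+1 (i + 1) + qbin k.+1 (i - 1) -
  (v ^ (2 * k%:Z + 2) + v ^ (- (2 * k%:Z + 2))) * qbin k.+1 i = qbin k i.
Proof.
rewrite !qbinS.
have := qbin_shift k i; have := qbin_shift k (i - 1); rewrite subrK.
have -> : i - 1 - k%:Z + 1 = i - k%:Z by ring.
have -> : i - 1 + k%:Z + 1 = i + k%:Z by ring.
have -> : i + 1 - k%:Z = i - k%:Z + 1 by ring.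
move=> e1 e2.
set D := qbracket _ * qbracket (2 * k + 2)%N.
have D0 : D != 0 by rewrite mulf_neq0 ?qbracket_neq0 // addnC.
have -> : qbin k (i + 1) * (qbracket (i + 1 + k%:Z + 1) * qbracket (i - k%:Z + 1) / D) =
  qbin k i * (qbracket (i + k%:Z + 1) * qbracket (i + 1 + k%:Z + 1) / D).
  transitivity (qbin k (i + 1) * qbracket (i - k%:Z + 1) * qbracket (i + 1 + k%:Z + 1) / D); first by ring.
  by rewrite e2; ring.
have -> : qbin k (i - 1) * (qbracket (i + k%:Z) * qbracket (i - 1 - k%:Z) / D) =
  qbin k i * (qbracket (i - k%:Z) * qbracket (i - 1 - k%:Z) / D).
  transitivity (qbin k (i - 1) * qbracket (i + k%:Z) * qbracket (i - 1 - k%:Z) / D); first by ring.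
  by rewrite -e1; ring.
apply: (mulIf D0).
(* With [qbin k i] factored out, an identity of Laurent polynomials in [v ^ i], [v ^ k] and [v]
   remains. *)
suff e : qbracket (i + k%:Z + 1) * qbracket (i + 1 + k%:Z + 1) + qbracket (i - k%:Z) * qbracket (i - 1 - k%:Z)
   - (v ^ (2 * k%:Z + 2) + v ^ (- (2 * k%:Z + 2))) * (qbracket (i + k%:Z + 1) * qbracket (i - k%:Z)) = D.
  by rewrite -[in RHS]e; field.
rewrite /D /qbracket.
have -> : (2 * k + 1)%N%:Z = k%:Z + k%:Z + 1 by lia.
have -> : (2 * k + 2)%N%:Z = k%:Z + k%:Z + 1 + 1 by lia.
have -> : 2 * k%:Z + 2 = k%:Z + k%:Z + 1 + 1 by lia.
rewrite -!invr_expz !vD -!invr_expz expr1z.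
have := vz_neq0 i; have := vz_neq0 k; move: (v ^ i) (v ^ k) => A B B0 A0.
by field; rewrite v0 v2_sub1_neq0 B0 A0.
Qed.

(** The factor of index [j] contributes [-2i + 4j + 2], and these add up to [-2k(i - k)]. For
    [i < k] the bound is positive, but the binomial is 0. *)
Lemma vge_qbin (k i : nat) : vge (- (2 * k%:Z * (i%:Z - k%:Z))) (qbin k i).
Proof.
case: (ltnP i k) => [/qbin_eq0->|]; first exact: vge_0.
elim: k => [|k IH] h; first by rewrite qbin0 mulr0 mul0r; apply: vge_1.
rewrite qbinS.
have -> : i%:Z + k%:Z + 1 = (i + k + 1)%N%:Z by lia.
have -> : i%:Z - k%:Z = (i - k)%N%:Z by lia.
rewrite invfM; apply: vge_le.
  apply: vge_M (IH (ltnW h)) (vge_M (vge_M (vge_qbracket _) (vge_qbracket _)) (vge_M (vge_qbracketV _) (vge_qbracketV _))); lia.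
lia.
Qed.

(** At [i = k] the recurrence keeps a single nonzero term on its left side, so the value 1 passes
    from [k] to [k + 1]. *)
Lemma qbin_diag k : qbin k k = 1.
Proof.
elim: k => [|k IH]; first by rewrite qbin0.
have := qbin_rec k k; rewrite (@qbin_eq0 k.+1 k) // mulr0 subr0 IH.
have -> : qbin k.+1 (k%:Z - 1) = 0.
  by case: k {IH} => [|k]; [exact: qbin_m1|rewrite (_ : k.+1%:Z - 1 = k) ?qbin_eq0 //; lia].
by rewrite addr0 (_ : k%:Z + 1 = k.+1) //; lia.
Qed.

(** * Gaussian factors and Gosper telescoping *)

Definition gauss (i : nat) : F := (-1) ^+ i * v ^+ (i * i.+1).

Lemma gaussS i : gauss i.+1 = - v ^+ (2 * i.+1) * gauss i.
Proof.
rewrite /gauss exprS (_ : i.+1 * i.+2 = 2 * i.+1 + i * i.+1)%N; last by lia.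
by rewrite exprD; ring.
Qed.

Lemma vge_sign n z N : vge N z -> vge N ((-1) ^+ n * z).
Proof. by rewrite -signr_odd; case: odd => h; rewrite ?expr0 ?mul1r // expr1 mulN1r; apply: vge_N. Qed.

Lemma vge_gauss i : vge (i * i.+1)%N (gauss i).
Proof. exact/vge_sign/vge_vnat. Qed.

(* Discrete antiderivative in [M] of [qbin k M * (gauss M.-1 - gauss M.+1)], found by Gosper summation. *)
Definition gosper (k M : nat) : F := (v ^ (- (2 * M%:Z)) - v ^ (- (2 * k%:Z))) * gauss M * qbin k M.

Lemma gosper_step k m : gosper k m.+2 - gosper k m.+1 = qbin k m.+1 * (gauss m - gauss m.+2).
Proof.
rewrite /gosper !gaussS; move: (gauss m) => G.
have := qbin_shift k m.+1; have -> : m.+1%:Z + 1 = m.+2 :> int by lia.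
rewrite /qbracket.
have -> : m.+1%:Z - k%:Z + 1 = m%:Z + 1 + 1 - k%:Z by lia.
have -> : m.+1%:Z + k%:Z + 1 = m%:Z + 1 + 1 + k%:Z by lia.
have -> : 2 * m.+2%:Z = (m%:Z + 1 + 1) + (m%:Z + 1 + 1) by lia.
have -> : 2 * m.+1%:Z = (m%:Z + 1) + (m%:Z + 1) by lia.
have -> : 2 * k%:Z = k%:Z + k%:Z by lia.
rewrite !exprnP.
have -> : (2 * m.+2)%N%:Z = (m%:Z + 1 + 1) + (m%:Z + 1 + 1) by lia.
have -> : (2 * m.+1)%N%:Z = (m%:Z + 1) + (m%:Z + 1) by lia.
rewrite -!invr_expz !vD -!invr_expz expr1z.
have := vz_neq0 m; have := vz_neq0 k; move: (v ^ m) (v ^ k) => A B B0 A0.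
move: (qbin k m.+2) (qbin k m.+1) => P Q.
set d := v - _; have d0 : d != 0.
  by apply: contra_neq v2_sub1_neq0 => /(congr1 ( *%R v)); rewrite mulrBr mulfV // mulr0.
move=> e.
have {e} : P * (A * v * v / B - (A * v * v / B)^-1) = Q * (A * v * v * B - (A * v * v * B)^-1).
  by apply: (mulIf (invr_neq0 d0)); rewrite -(mulrA P) -(mulrA Q).
move=> e; apply/eqP; rewrite -subr_eq0; apply/eqP.
(* The two sides differ by an explicit multiple of the shift relation [e]; here [A = v ^ m] and
   [B = v ^ k]. *)
transitivity (- (A * v * v * (A * v) * (A * v) / B * G) *
  (P * (A * v * v / B - (A * v * v / B)^-1) - Q * (A * v * v * B - (A * v * v * B)^-1))).
  by field; rewrite B0 A0 v0.
by rewrite e subrr mulr0.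
Qed.

(** Suited to the boundary terms: a Gaussian factor gives [M^2], while binomials with fixed [k] and
    index shifts cost only a linear amount. *)
Lemma tends0_quad (B : nat) (s : nat -> F) :
  (forall M : nat, vge ((M * M)%N%:Z - (B * M + B)%N%:Z) (s M)) -> tends s 0.
Proof.
move=> h; apply/tends0P => N; exists (2 * B + `|N| + 1)%N => M hM.
apply: vge_le (h M) _.
have h1 : (M * (2 * B + `|N| + 1) <= M * M)%N by rewrite leq_mul2l hM orbT.
nia.
Qed.

(* [(-1)^j q^(j(j+1)/2) / (q; q)_j]. *)
Definition euler_term (j : nat) : F := \prod_(l < j) (- v ^+ (2 * l.+1) / (1 - v ^+ (2 * l.+1))).

Lemma euler_term0 : euler_term 0 = 1.
Proof. by rewrite /euler_term big_ord0. Qed.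

Lemma euler_termS j : euler_term j.+1 = euler_term j * (- v ^+ (2 * j.+1) / (1 - v ^+ (2 * j.+1))).
Proof. by rewrite /euler_term big_ord_recr. Qed.

Lemma vge_euler_term j : vge (2 * j)%N (euler_term j).
Proof.
elim: j => [|j IH]; first by rewrite euler_term0; apply: vge_1.
rewrite euler_termS.
apply: vge_le (vge_M IH (vge_M (vge_N (vge_vnat (2 * j.+1))) (vge_v2 (ltn0Sn j)))) _; lia.
Qed.

(** Truncation of Euler's series for (zq; q)_oo at z = q^m. *)
Definition euler_sum (m M : nat) : F := \sum_(j < M) euler_term j * v ^+ (2 * m * j).

(** Functional equation E(z) = (1 - zq) E(zq) at z = q^m. The last sum is one term shorter, which
    makes the truncated equation exact. *)
Lemma euler_sum_partial m M : euler_sum m M.+1 = euler_sum m.+1 M.+1 - v ^+ (2 * m.+1) * euler_sum m.+1 M.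
Proof.
elim: M => [|M IH].
  by rewrite /euler_sum !big_ord1 big_ord0 !muln0 mulr0 subr0.
rewrite /euler_sum big_ord_recr /= -/(euler_sum m M.+1) IH /euler_sum big_ord_recr [\sum_(j < M.+2) _]big_ord_recr /=.
rewrite !big_ord_recr /= -/(euler_sum m.+1 M) euler_termS.
have -> : (2 * m * M.+1 = 2 * m * M + 2 * m)%N by lia.
have -> : (2 * m.+1 * M = 2 * m * M + 2 * M)%N by lia.
have -> : (2 * m.+1 * M.+1 = 2 * m * M + 2 * m + 2 * M.+1)%N by lia.
have -> : (2 * m.+1 = 2 * m + 2)%N by lia.
have -> : (2 * M.+1 = 2 * M + 2)%N by lia.
rewrite !exprD; field; rewrite -!exprD.
by rewrite (_ : M + M + 2 = 2 * M.+1)%N ?v2_neq1 //; lia.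
Qed.

Lemma euler_sum_cvg m : exists E, tends (euler_sum m) E.
Proof.
apply: (@series_cvg (fun j => euler_term j * v ^+ (2 * m * j))).
apply/tends0P => N; exists `|N|%N => M hM.
apply: vge_le (vge_M (vge_euler_term M) (vge_vX _)) _; lia.
Qed.

Lemma euler_sum_rec m E E' : tends (euler_sum m) E -> tends (euler_sum m.+1) E' -> E = (1 - v ^+ (2 * m.+1)) * E'.
Proof.
move=> h h'; apply: (tends_uniq (tends_shift 1 h)).
rewrite mulrBl mul1r.
have := tendsB (tends_shift 1 h') (tendsM (tends_const (v ^+ (2 * m.+1))) h').
by apply: tends_ext => M; rewrite addn1 (euler_sum_partial m).
Qed.

Lemma euler_sum_head m E : tends (euler_sum m) E -> vge (2 * m)%N (E - 1).
Proof.
move=> h; have := @series_tail (fun j => euler_term j * v ^+ (2 * m * j)) E (2 * m)%N 1 h.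
rewrite big_ord1 muln0 mulr1 euler_term0; apply=> j j1.
apply: vge_le (vge_M (vge_euler_term j) (vge_vnat _)) _; nia.
Qed.

(* With [E_m] the limit of [euler_sum m], [E_m = (1 - q^(m+1)) E_(m+1)] and [E_m] tends to 1. *)
Lemma euler E : tends (euler_sum 0) E -> tends (qprod (v ^+ 2)) E.
Proof.
move=> h0.
have H m E' : tends (euler_sum m) E' -> E = qprod (v ^+ 2) m * E'.
  elim: m E' => [|m IH] E' h.
    by rewrite /qprod big_ord0 mul1r; apply: tends_uniq h0 h.
  have [E1 h1] := euler_sum_cvg m; rewrite (IH _ h1) (euler_sum_rec h1 h) qprodS -exprD mulrA.
  by rewrite -(mulnDr 2 1 m) add1n.
move=> N; exists `|N|%N => m hm; have [E' h'] := euler_sum_cvg m.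
rewrite (H _ _ h'); have -> : qprod (v ^+ 2) m - qprod (v ^+ 2) m * E' = - (qprod (v ^+ 2) m * (E' - 1)) by ring.
apply: vge_N; apply: vge_le (vge_M (vge_qprod m (vge_vX 2)) (euler_sum_head h')) _; lia.
Qed.

(** * Comparison of R_k / g_k with Euler's series *)

Lemma gauss_neq0 i : gauss i != 0.
Proof. by rewrite /gauss mulf_neq0 ?expf_neq0 // oppr_eq0 oner_eq0. Qed.

Lemma vge_gaussV i : vge (- (i * i.+1)%N%:Z) (gauss i)^-1.
Proof.
rewrite /gauss invfM -exprVn invrN1; apply: vge_sign; rewrite exprnN; exact: vge_v.
Qed.

(** The term of R_k / g_k at i = k + j, with theta_i replaced by its leading term g_i. *)
Definition qbin_gauss_ratio (k j : nat) : F := qbin k (k + j)%N * gauss (k + j) / gauss k.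

Lemma qbin_gauss_ratio0 k : qbin_gauss_ratio k 0 = 1.
Proof. by rewrite /qbin_gauss_ratio addn0 qbin_diag mul1r mulfV ?gauss_neq0. Qed.

Lemma qbin_gauss_ratioS k j : qbin_gauss_ratio k j.+1 =
  - v ^+ (2 * j.+1) / (1 - v ^+ (2 * j.+1)) * ((1 - v ^+ (2 * (2 * k + j.+1))) * qbin_gauss_ratio k j).
Proof.
have := qbin_shift k (k + j)%N.
have -> : (k + j)%N%:Z + 1 = (k + j.+1)%N by lia.
have -> : (k + j)%N%:Z - k%:Z + 1 = j.+1 by lia.
have -> : (k + j)%N%:Z + k%:Z + 1 = (2 * k + j.+1)%N by lia.
move=> e; have b0 := qbracket_neq0 (ltn0Sn j).
rewrite /qbin_gauss_ratio; have {e} -> : qbin k (k + j.+1)%N = qbin k (k + j)%N * qbracket (2 * k + j.+1)%N / qbracket j.+1.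
  by rewrite -e mulfK.
rewrite !qbracketE (addnS k j) gaussS.
have -> : 1 - (2 * k + j.+1)%N%:Z = (1 - j.+1%:Z) - (2 * k)%N%:Z by lia.
have -> : (2 * (k + j).+1 = 2 * k + 2 * j.+1)%N by lia.
have := v2_neq1 (ltn0Sn j); have := v2_neq1 (isT : (0 < 1)%N); rewrite muln1.
rewrite vD -exprnN exprD; have := vz_neq0 (1 - j.+1%:Z); have := gauss_neq0 k.
have : v ^+ (2 * k) != 0 by rewrite expf_neq0.
move: (v ^+ (2 * k)) (v ^ (1 - _)) (v ^+ (2 * j.+1)) (gauss (k + j)) (gauss k) => a b c d e a0 e0 b0' h1 h2.
by field; rewrite a0 e0 b0' h1 h2.
Qed.

(** The two recurrences in [j] differ by the factor [1 - v ^+ (2 * (2 * k + j.+1))], which is 1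
    modulo [v ^+ (2 * k)]. The estimate is uniform in [j], so it survives summation. *)
Lemma qbin_gauss_ratio_near k j : vge 0 (qbin_gauss_ratio k j) /\ vge (2 * k)%N (qbin_gauss_ratio k j - euler_term j).
Proof.
elim: j => [|j [IH1 IH2]].
  by rewrite qbin_gauss_ratio0 euler_term0 subrr; split; [apply: vge_1|apply: vge_0].
rewrite qbin_gauss_ratioS euler_termS; set c := - _ / _.
have hc : vge 0 c.
  by have := vge_M (vge_N (vge_vX (2 * j.+1))) (vge_v2 (ltn0Sn j)); rewrite addr0.
set t := v ^+ _; have ht : vge (2 * k)%N t by apply: vge_le (vge_vnat _) _; lia.
split.
  have h : vge 0 (1 - t) by apply: vge_B; [apply: vge_1|apply: vge_vX].
  by have := vge_M hc (vge_M h IH1); rewrite !addr0.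
have -> : c * ((1 - t) * qbin_gauss_ratio k j) - euler_term j * c = c * ((qbin_gauss_ratio k j - euler_term j) - t * qbin_gauss_ratio k j) by ring.
rewrite -[X in vge X]add0r; apply: vge_M => //; apply: vge_B => //.
by have := vge_M ht IH1; rewrite addr0.
Qed.

(** * Partial theta functions, the sums R_k and the product formula *)

Section Theta.
Variable x : F.
Hypotheses (x0 : x != 0) (Ox : vge 0 x) (OxV : vge 0 x^-1).
Hypotheses (x1 : 1 - x != 0) (Ox1 : vge 0 (1 - x)^-1).

Definition xsym (n : nat) : F := x ^+ n + x ^- n.

Lemma xsymS n : (x + x^-1) * xsym n.+1 = xsym n.+2 + xsym n.
Proof. by rewrite /xsym !exprS !invfM; have := expf_neq0 n x0; move: (x ^+ n) => t t0; field; rewrite x0 t0. Qed.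

Lemma vge_X0 z n : vge 0 z -> vge 0 (z ^+ n).
Proof.
move=> h; elim: n => [|n IH]; first exact: vge_1.
by rewrite exprS; have := vge_M h IH; rewrite addr0.
Qed.

Lemma vge_xsym n : vge 0 (xsym n).
Proof. by apply: vge_D; [|rewrite -exprVn]; apply: vge_X0. Qed.

Definition theta_summand (i n : nat) : F := gauss (i + n.+1) * xsym n.+1.
Variable theta : nat -> F.
Hypothesis theta_def : forall i, tends (fun M => gauss i + \sum_(n < M) theta_summand i n) (theta i).

Lemma vge_theta_summand i n : vge ((i + n.+1) * (i + n.+2))%N (theta_summand i n).
Proof. by rewrite /theta_summand !addnS -[X in vge X]addr0; apply: vge_M; [apply: vge_gauss|apply: vge_xsym]. Qed.

(** The correction [gauss i - gauss i.+2] comes from the constant terms: that of theta_i is not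
    produced, and that of theta_(i+2) is produced twice because [xsym 0 = 2]. The last two terms are
    due to the truncation. *)
Lemma theta_partial i M :
  (x + x^-1) * (gauss i.+1 + \sum_(n < M) theta_summand i.+1 n) =
  (gauss i.+2 + \sum_(n < M) theta_summand i.+2 n) + (gauss i + \sum_(n < M) theta_summand i n) - (gauss i - gauss i.+2) +
  gauss (i.+1 + M) * xsym M.+1 - gauss (i.+2 + M) * xsym M.
Proof.
elim: M => [|M IH].
  by rewrite !big_ord0 !addr0 !addn0 /xsym expr1 expr0 invr1; ring.
rewrite !big_ord_recr /= !addrA mulrDr IH /theta_summand [(x + _) * (_ * _)]mulrCA xsymS.
rewrite !addSn !addnS; ring.
Qed.

Lemma theta_rec i : (x + x^-1) * theta i.+1 = theta i.+2 + theta i - (gauss i - gauss i.+2).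
Proof.
have h0 (j k e : nat) : tends (fun M => gauss (j + M) * xsym (M + k)) 0.
  apply: (@tends0_quad 0) => M; apply: vge_le.
    by apply: vge_M; [apply: vge_gauss|apply: vge_xsym].
  by nia.
have h1 := tendsM (tends_const (x + x^-1)) (theta_def i.+1).
have h2 := tendsB (tendsD (tendsB (tendsD (theta_def i.+2) (theta_def i)) (tends_const (gauss i - gauss i.+2)))
  (h0 i.+1 1 0)%N) (h0 i.+2 0 0)%N.
rewrite -[RHS]addr0 -[RHS]subr0; apply: (tends_uniq h1); apply: tends_ext h2 => M.
by rewrite theta_partial addn1 addn0.
Qed.

Lemma theta_head i : vge (i.+1 * i.+2)%N (theta i - gauss i).
Proof.
apply: (tends_vge (tendsB (theta_def i) (tends_const _))); exists 0%N => M _.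
rewrite addrAC subrr add0r; apply: vge_sum => n _.
apply: vge_le (vge_theta_summand i n) _; nia.
Qed.

Lemma vge_theta i : vge (i * i.+1)%N (theta i).
Proof.
rewrite -[theta i](subrK (gauss i)); apply: vge_D; last exact: vge_gauss.
by apply: vge_le (theta_head i) _; nia.
Qed.

Lemma vge_qbin_theta (k i : nat) :
  vge (- (2 * k%:Z * (i%:Z - k%:Z)) + (i * i.+1)%N) (qbin k i * theta i).
Proof. exact: vge_M (vge_qbin k i) (vge_theta i). Qed.

Definition theta_sum (k M : nat) := \sum_(i < M) qbin k i * theta i.

(** Summation by parts; [gosper] collects the corrections of the theta recurrence. *)
Lemma theta_sum_partial k M :
  (x + x^-1 - (v ^ (2 * k%:Z + 2) + v ^ (- (2 * k%:Z + 2)))) * theta_sum k.+1 M.+1 =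
  theta_sum k M.+1 + qbin k.+1 M * theta M.+1 - qbin k.+1 M.+1 * theta M - gosper k.+1 M.+1.
Proof.
elim: M => [|M IH].
  (* At [k = 0] the prefactor of [gosper] vanishes, for larger [k] the binomial does. *)
  have h0 : gosper k.+1 1 = 0.
    by rewrite /gosper; case: k => [|k]; [rewrite subrr !mul0r|rewrite [qbin _ _]qbin_eq0 ?mulr0].
  have := qbin_rec k 0; rewrite sub0r qbin_m1 add0r (@qbin_eq0 k.+1 0) // mulr0 addr0 subr0 => e.
  by rewrite /theta_sum !big_ord1 h0 (@qbin_eq0 k.+1 0) // -e; ring.
have := gosper_step k.+1 M; have := qbin_rec k M.+1.
have -> : M.+1%:Z + 1 = M.+2 by lia.
have -> : M.+1%:Z - 1 = M by lia.
move=> e1 e2; rewrite /theta_sum big_ord_recr /= -/(theta_sum _ _) mulrDr IH [in RHS]big_ord_recr /= -/(theta_sum _ _).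
have -> : gosper k.+1 M.+2 = gosper k.+1 M.+1 + qbin k.+1 M.+1 * (gauss M - gauss M.+2) by rewrite -e2; ring.
rewrite -e1 mulrBl [(x + _) * (_ * _)]mulrCA theta_rec; ring.
Qed.

Lemma theta_sum_cvg k : exists L, tends (theta_sum k) L.
Proof.
apply: (@series_cvg (fun i => qbin k i * theta i)); apply: (@tends0_quad (2 * k)) => M.
by apply: vge_le (vge_qbin_theta k M) _; nia.
Qed.

Lemma theta_sum_rec k L L' : tends (theta_sum k) L -> tends (theta_sum k.+1) L' ->
  L = (x + x^-1 - (v ^ (2 * k%:Z + 2) + v ^ (- (2 * k%:Z + 2)))) * L'.
Proof.
move=> h h'.
have b1 : tends (fun M => qbin k.+1 M * theta M.+1) 0.
  apply: (@tends0_quad (2 * k.+1)) => M.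
  by apply: vge_le (vge_M (vge_qbin k.+1 M) (vge_theta M.+1)) _; nia.
have b2 : tends (fun M => qbin k.+1 M.+1 * theta M) 0.
  apply: (@tends0_quad (2 * k.+1)) => M.
  by apply: vge_le (vge_M (vge_qbin k.+1 M.+1) (vge_theta M)) _; nia.
have b3 : tends (fun M => gosper k.+1 (M + 1)) 0.
  (* The linear loss [2k + 3] is 2 from the prefactor plus [2k + 2] from the binomial, minus 1 from
     the Gaussian factor. *)
  apply: tends_shift; apply: (@tends0_quad (2 * k + 3)) => M.
  have d : vge (- (2 * M%:Z + 2 * k.+1%:Z)) (v ^ (- (2 * M%:Z)) - v ^ (- (2 * k.+1%:Z))).
    by apply: vge_B; apply: vge_le (vge_v _) _; lia.
  by apply: vge_le (vge_M (vge_M d (vge_gauss M)) (vge_qbin k.+1 M)) _; nia.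
have hL := tendsB (tendsB (tendsD (tends_shift 1 h) b1) b2) b3.
have hR := tendsM (tends_const (x + x^-1 - (v ^ (2 * k%:Z + 2) + v ^ (- (2 * k%:Z + 2))))) (tends_shift 1 h').
move: hL; rewrite addr0 !subr0 => hL; apply/esym/(tends_uniq hR); apply: tends_ext hL => M.
by rewrite !addn1 -theta_sum_partial.
Qed.

(** Terms with [i < k] vanish, so the sum is reindexed by [i = k + j]. Replacing theta_i by g_i
    costs a relative error of order [2(i + 1)], and replacing the ratio by Euler's term one of order
    [2k]. *)
Lemma theta_sum_limit k L E : tends (theta_sum k) L -> tends (euler_sum 0) E -> vge (2 * k)%N (L / gauss k - E).
Proof.
move=> hL hE; pose u j := qbin k (k + j)%N * theta (k + j)%N / gauss k.
apply: (@series_vge (fun j => u j - euler_term j)); last first.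
  move=> j; have [h1 h2] := qbin_gauss_ratio_near k j.
  have -> : u j - euler_term j = (qbin_gauss_ratio k j - euler_term j) + qbin_gauss_ratio k j * ((theta (k + j)%N - gauss (k + j)) / gauss (k + j)).
    by rewrite /u /qbin_gauss_ratio; field; rewrite !gauss_neq0.
  apply: vge_D => //.
  apply: vge_le (vge_M h1 (vge_M (theta_head (k + j)) (vge_gaussV (k + j)))) _; nia.
have := tendsB (tendsM (tends_shift k hL) (tends_const (gauss k)^-1)) hE.
apply: tends_ext => M; rewrite sumrB; congr (_ - _); last first.
  by rewrite /euler_sum; apply: eq_bigr => j _; rewrite muln0 mul0n mulr1.
rewrite /theta_sum addnC big_split_ord /= big1 ?add0r.
  by rewrite mulr_suml; apply: eq_bigr.
by move=> i _; rewrite qbin_eq0 ?mul0r //=.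
Qed.

Definition habiro_term (k : nat) : F := gauss k / (qprod x k.+1 * qprod (v ^+ 2 / x) k).

Lemma vge_xv2 : vge 1 (x * v ^+ 2).
Proof. by apply: vge_le (vge_M Ox (vge_vnat 2)) _. Qed.

Lemma vge_v2x : vge 1 (v ^+ 2 / x).
Proof. by apply: vge_le (vge_M (vge_vnat 2) OxV) _. Qed.

Lemma qprod_x k : qprod x k.+1 = (1 - x) * qprod (x * v ^+ 2) k.
Proof.
rewrite /qprod big_ord_recl /= muln0 mulr1; congr (_ * _).
apply: eq_bigr => i _; rewrite /bump /= mulnDr muln1 exprD; ring.
Qed.

Lemma qprod_x_unit k : qprod x k.+1 != 0 /\ vge 0 (qprod x k.+1)^-1.
Proof.
have [h1 h2] := qprod_unit k vge_xv2.
rewrite qprod_x mulf_neq0 //; split=> //; rewrite invfM.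
by have := vge_M Ox1 h2; rewrite addr0.
Qed.

Lemma habiro_term_neq0 k : habiro_term k != 0.
Proof.
have [h1 _] := qprod_unit k vge_v2x; have [h2 _] := qprod_x_unit k.
by rewrite /habiro_term mulf_neq0 ?gauss_neq0 // invr_eq0 mulf_neq0.
Qed.

Lemma vge_habiro_term k : vge (k * k.+1)%N (habiro_term k).
Proof.
have [_ h1] := qprod_unit k vge_v2x; have [_ h2] := qprod_x_unit k.
rewrite /habiro_term invfM -[X in vge X]addr0; apply: vge_M; first exact: vge_gauss.
by have := vge_M h2 h1; rewrite addr0.
Qed.

(** With Q = q^(k+1), the new denominator factors satisfy (1 - xQ)(1 - Q/x) = -Q (x + 1/x - Q -
    1/Q), and -Q is the quotient of consecutive Gaussian factors. *)
Lemma habiro_term_rec k : habiro_term k = (x + x^-1 - (v ^ (2 * k%:Z + 2) + v ^ (- (2 * k%:Z + 2)))) * habiro_term k.+1.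
Proof.
have [h1 _] := qprod_unit k.+1 vge_v2x; have [h2 _] := qprod_x_unit k.+1.
move: h1 h2; rewrite /habiro_term gaussS [qprod x k.+2]qprodS [qprod _ k.+1 in X in X -> _]qprodS.
rewrite [qprod (v ^+ 2 / x) k.+1]qprodS !mulf_eq0 !negb_or => /andP[h1 h2] /andP[h3 h4].
move: h2 h4.
have -> : (2 * k.+1 = 2 * k + 2)%N by lia.
have -> : 2 * k%:Z + 2 = (2 * k + 2)%N by lia.
rewrite -invr_expz -exprnP exprD.
have : v ^+ (2 * k) != 0 by rewrite expf_neq0.
move: (v ^+ (2 * k)) (qprod x k.+1) (qprod _ k) h1 h3 (gauss k) => a b c c0 b0 d a0 h2 h4.
have h2' : x - v ^+ 2 * a != 0.
  apply: contra_neq h2 => e; have -> : x = v ^+ 2 * a by apply/eqP; rewrite -subr_eq0 e.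
  by field; rewrite v0 a0.
by field; rewrite x0 h2' c0 h4 b0 v0 a0.
Qed.

(* [theta_sum k / habiro_term k] has a limit independent of [k]; letting [k] grow identifies it. *)
Lemma theta_product qinf xinf yinf k :
  tends (qprod (v ^+ 2)) qinf -> tends (qprod x) xinf -> tends (qprod (v ^+ 2 / x)) yinf ->
  tends (theta_sum k) (qinf * xinf * yinf * habiro_term k).
Proof.
move=> hq hx hy; have [R0 hR0] := theta_sum_cvg 0.
have H j L : tends (theta_sum j) L -> L = R0 / habiro_term 0 * habiro_term j.
  elim: j L => [|j IH] L h; first by rewrite mulfVK ?habiro_term_neq0 //; apply: tends_uniq h hR0.
  have [L1 h1] := theta_sum_cvg j.
  have e1 := theta_sum_rec h1 h; have e2 := habiro_term_rec j; have e3 := IH _ h1.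
  (* The multiplier divides the nonzero [habiro_term j], hence can be cancelled. *)
  set s := x + _ - _ in e1 e2; have s0 : s != 0.
    by have := habiro_term_neq0 j; rewrite e2 mulf_eq0 negb_or => /andP[].
  by apply: (mulfI s0); rewrite -e1 e3 e2; ring.
have [E hE] := euler_sum_cvg 0.
have <- : E = qinf by apply: tends_uniq (euler hE) hq.
suff <- : R0 / habiro_term 0 = E * xinf * yinf.
  by have [L h] := theta_sum_cvg k; rewrite -(H _ _ h).
(* Multiplying the estimate of [theta_sum_limit] by the integral denominator of s_k puts this
   product within [v ^+ (2 * k)] of the constant ratio. *)
apply: (@tends_uniq (fun k => E * qprod x k.+1 * qprod (v ^+ 2 / x) k)); last first.
  apply: tendsM => //; apply: tendsM; first exact: tends_const.
  by have := tends_shift 1 hx; apply: tends_ext => M; rewrite addn1.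
move=> N; exists `|N|%N => j hj.
have [L h] := theta_sum_cvg j; have := theta_sum_limit h hE; rewrite (H _ _ h).
have [h1 _] := qprod_unit j vge_v2x; have [h2 _] := qprod_x_unit j.
move=> hv.
have h0 : vge 0 (qprod x j.+1 * qprod (v ^+ 2 / x) j).
  have := vge_M (vge_qprod j.+1 Ox) (vge_qprod j (vge_le vge_v2x ler01)); by rewrite addr0.
have -> : E * qprod x j.+1 * qprod (v ^+ 2 / x) j - R0 / habiro_term 0 =
    - (qprod x j.+1 * qprod (v ^+ 2 / x) j * (R0 / habiro_term 0 * habiro_term j / gauss j - E)).
  rewrite [habiro_term j]/habiro_term; move: (habiro_term_neq0 0); move: (habiro_term 0) => s0 hs0.
  by field; rewrite h1 h2 gauss_neq0 hs0.
apply: vge_N; apply: vge_le (vge_M h0 hv) _; lia.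
Qed.

(** Two factors are 1 modulo [v]; the factor (x; q)_oo becomes so after division by the unit
    [1 - x]. *)
Lemma theta_product_neq0 qinf xinf yinf :
  tends (qprod (v ^+ 2)) qinf -> tends (qprod x) xinf -> tends (qprod (v ^+ 2 / x)) yinf ->
  qinf * xinf * yinf != 0.
Proof.
move=> hq hx hy.
have h1 a L : vge 1 a -> tends (qprod a) L -> L != 0.
  move=> ha h; apply: vge_neq0.
  have -> : L - 1 = (L - (1 - a)) - a by ring.
  by apply: vge_B => //; apply: qprod_inf_head h; apply: vge_le ha _.
have q0 : qinf != 0 by apply: h1 hq; apply: vge_le (vge_vnat 2) _.
have y0 := h1 _ _ vge_v2x hy.
suff : xinf / (1 - x) != 0 by rewrite !mulf_eq0 !negb_or q0 y0 => /andP[->].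
apply: vge_neq0; have -> : xinf / (1 - x) - 1 = (xinf - (1 - x)) / (1 - x) by field.
by have := vge_M (qprod_inf_head Ox hx) Ox1; rewrite addr0.
Qed.

(* Swapping the sums is justified by the valuation of [a k * qbin k i * theta i], which is at least
   [2 C + 2 + (i - k)^2 + i + k]. *)
Lemma inverted_habiro (a : nat -> F) (C : int) :
  (forall k : nat, vge (2 * C - (k%:Z * k%:Z - k%:Z - 2)) (a k)) ->
  exists A B, [/\ tends (fun M => \sum_(k < M) a k * habiro_term k) A,
    tends (fun M => \sum_(i < M) (\sum_(k < i.+1) qbin k i * a k) * theta i) B &
    forall qinf xinf yinf,
      tends (qprod (v ^+ 2)) qinf -> tends (qprod x) xinf -> tends (qprod (v ^+ 2 / x)) yinf ->
      A = (qinf * xinf * yinf)^-1 * B].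
Proof.
move=> ha.
have [A hA] : exists A, tends (fun M => \sum_(k < M) a k * habiro_term k) A.
  apply: (@series_cvg (fun k => a k * habiro_term k)); apply/tends0P => N; exists (`|N| + `|C| * 2)%N => M hM.
  apply: vge_le (vge_M (ha M) (vge_habiro_term M)) _; nia.
have hu k i : vge (2 * C + i%:Z) (a k * (qbin k i * theta i)).
  apply: vge_le (vge_M (ha k) (vge_qbin_theta k i)) _.
  have := sqr_ge0 (i%:Z - k%:Z); nia.
have [B hB] : exists B, tends (fun M => \sum_(i < M) (\sum_(k < i.+1) qbin k i * a k) * theta i) B.
  apply: (@series_cvg (fun i => (\sum_(k < i.+1) qbin k i * a k) * theta i)); apply/tends0P => N; exists (`|N| + `|C| * 2)%N => M hM.
  rewrite mulr_suml; apply: vge_sum => k _.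
  have -> : qbin k M * a k * theta M = a k * (qbin k M * theta M) by ring.
  apply: vge_le (hu k M) _; lia.
exists A, B; split=> // qinf xinf yinf hq hx hy.
have T0 := theta_product_neq0 hq hx hy; set T := _ * yinf in T0 *.
apply: (mulfI T0); rewrite mulVKf //.
apply: (tends_uniq (tendsM (tends_const T) hA)).
rewrite -[B]add0r.
(* [T * habiro_term k] is the full inner sum, so each difference is a tail over [i >= M], bounded
   uniformly in [k]. *)
have hd : tends (fun M => \sum_(k < M) a k * (T * habiro_term k - theta_sum k M)) 0.
  apply/tends0P => N; exists (`|N| + `|C| * 2)%N => M hM; apply: vge_sum => k _.
  have := tendsM (tends_const (a k)) (theta_product k hq hx hy).
  move=> /(tends_ext (fun M => mulr_sumr _ _ _ _)) h.
  have := @series_tail (fun i => a k * (qbin k i * theta i)) _ (2 * C + M%:Z) M h.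
  rewrite -mulr_sumr -mulrBr => h'; apply: vge_le (h' _) _; last by lia.
  by move=> j hj; apply: vge_le (hu k j) _; lia.
apply: tends_ext (tendsD hd hB) => M.
rewrite mulr_sumr; apply/eqP; rewrite -subr_eq0 -addrA addrC; apply/eqP.
(* The triangle [k <= i] is filled up to a square by binomials that vanish. *)
have -> : \sum_(i < M) (\sum_(k < i.+1) qbin k i * a k) * theta i = \sum_(k < M) a k * theta_sum k M.
  transitivity (\sum_(i < M) \sum_(k < M) a k * (qbin k i * theta i)).
    apply: eq_bigr => i _; rewrite mulr_suml (big_ord_widen M (fun k => qbin k i * a k * theta i)) //.
    rewrite big_mkcond; apply: eq_bigr => k _; case: ltnP => [_|h]; first by ring.
    by rewrite (qbin_eq0 h); ring.
  by rewrite exchange_big; apply: eq_bigr => k _; rewrite -mulr_sumr.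
rewrite -!sumrB -big_split big1 // => k _ /=; ring.
Qed.
End Theta.
End Valued.

(** * Formal power series *)

Record fps (k : fieldType) := Fps { fpsc : nat -> k }.

Section Fps.
Variable k : fieldType.
Implicit Types f g h : fps k.

Lemma fpsP f g : (forall n, fpsc f n = fpsc g n) -> f = g.
Proof. by case: f g => [f] [g] /= /funext ->. Qed.

HB.instance Definition _ := gen_eqMixin (fps k).
HB.instance Definition _ := gen_choiceMixin (fps k).

Definition fps_add f g := Fps (fun n => fpsc f n + fpsc g n).
Definition fps_opp f := Fps (fun n => - fpsc f n).
Definition fps_zero : fps k := Fps (fun=> 0).
Definition fps_one : fps k := Fps (fun n => (n == 0%N)%:R).
Definition fps_mul f g := Fps (fun n => \sum_(i < n.+1) fpsc f i * fpsc g (n - i)).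

Fact fps_addA : associative fps_add.
Proof. by move=> f g h; apply: fpsP => n; apply: addrA. Qed.
Fact fps_addC : commutative fps_add.
Proof. by move=> f g; apply: fpsP => n; apply: addrC. Qed.
Fact fps_add0 : left_id fps_zero fps_add.
Proof. by move=> f; apply: fpsP => n; apply: add0r. Qed.
Fact fps_addN : left_inverse fps_zero fps_opp fps_add.
Proof. by move=> f; apply: fpsP => n; apply: addNr. Qed.

HB.instance Definition _ := GRing.isZmodule.Build (fps k) fps_addA fps_addC fps_add0 fps_addN.

(** Below degree [N] the Cauchy product agrees with the product of truncations, so commutativity and
    associativity are inherited from polynomials. *)
Definition fps_trunc (N : nat) f : {poly k} := \poly_(i < N) fpsc f i.

Lemma fps_mul_trunc f g N n : (n < N)%N ->
  fpsc (fps_mul f g) n = (fps_trunc N f * fps_trunc N g)`_n.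
Proof.
move=> h; rewrite coefM /=; apply: eq_bigr => i _.
by rewrite !coef_poly !ifT // ?(leq_ltn_trans _ h) ?leq_subr // -ltnS.
Qed.

Fact fps_mulC : commutative fps_mul.
Proof. by move=> f g; apply: fpsP => n; rewrite !(fps_mul_trunc _ _ (ltnSn n)) mulrC. Qed.

Lemma coef_trunc_mul f g N n (p : {poly k}) : (n < N)%N ->
  (fps_trunc N (fps_mul f g) * p)`_n = (fps_trunc N f * fps_trunc N g * p)`_n.
Proof.
move=> h; rewrite !coefM; apply: eq_bigr => i _; congr (_ * _).
have hi : (i < N)%N by rewrite (leq_ltn_trans _ h) // -ltnS.
by rewrite coef_poly hi (fps_mul_trunc _ _ hi).
Qed.

Fact fps_mulA : associative fps_mul.
Proof.
move=> f g h; apply: fpsP => n.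
rewrite [fps_mul f _]fps_mulC !(fps_mul_trunc _ _ (ltnSn n)) !coef_trunc_mul //.
by rewrite [in LHS]mulrC mulrA.
Qed.

Fact fps_mul1 : left_id fps_one fps_mul.
Proof.
move=> f; apply: fpsP => n /=; rewrite big_ord_recl /= mul1r subn0 big1 ?addr0 // => i _.
by rewrite mul0r.
Qed.

Fact fps_mulDl : left_distributive fps_mul fps_add.
Proof.
move=> f g h; apply: fpsP => n /=; rewrite -big_split; apply: eq_bigr => i _.
exact: mulrDl.
Qed.

Fact fps_1neq0 : fps_one != 0 :> fps k.
Proof. by apply/eqP => /(congr1 (fun f => fpsc f 0)) /eqP; rewrite oner_eq0. Qed.

HB.instance Definition _ := GRing.Zmodule_isComNzRing.Build (fps k)
  fps_mulA fps_mulC fps_mul1 fps_mulDl fps_1neq0.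

Definition fps_unit : {pred fps k} := fun f => fpsc f 0 != 0.

(* [g_n] solves [sum_(i <= n) f_i g_(n-i) = [n = 0]], given [g_0, ..., g_(n-1)]. *)
Fixpoint fps_inv_upto f (n : nat) : nat -> k :=
  if n is m.+1 then
    let p := fps_inv_upto f m in
    fun j => if j == m then ((m == 0%N)%:R - \sum_(i < m) fpsc f i.+1 * p (m - i.+1)%N) / fpsc f 0
             else p j
  else fun=> 0.

Definition fps_inv f : fps k :=
  if fpsc f 0 != 0 then Fps (fun n => fps_inv_upto f n.+1 n) else f.

Lemma fps_inv_uptoE f n j : (j < n)%N -> fps_inv_upto f n j = fps_inv_upto f j.+1 j.
Proof.
elim: n => // n IH; rewrite ltnS leq_eqVlt => /orP[/eqP->//|h].
by rewrite [LHS]/= ltn_eqF // IH.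
Qed.

Fact fps_mulV : {in fps_unit, left_inverse 1 fps_inv *%R}.
Proof.
move=> f hf; apply: fpsP => n; rewrite mulrC /fps_inv ifT //.
rewrite [LHS]/= big_ord_recl /= subn0 eqxx mulrC divfK //.
rewrite -[RHS](subrK (\sum_(i < n) fpsc f i.+1 * fps_inv_upto f n (n - i.+1))).
congr (_ + _); apply: eq_bigr => i _; rewrite /bump add1n (@fps_inv_uptoE f n) //.
by have := ltn_ord i; lia.
Qed.

Fact fps_unitP f g : g * f = 1 -> fps_unit f.
Proof.
move=> /(congr1 (fun f => fpsc f 0)) /=; rewrite big_ord1 => e.
by rewrite /fps_unit; apply/eqP => h; move/eqP: e; rewrite h mulr0 eq_sym oner_eq0.
Qed.

Fact fps_invr_out : {in [predC fps_unit], fps_inv =1 id}.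
Proof. by move=> f; rewrite inE /fps_inv => /negbTE h; rewrite ifF. Qed.

HB.instance Definition _ := GRing.ComNzRing_hasMulInverse.Build (fps k)
  fps_mulV fps_unitP fps_invr_out.

Definition fpsX : fps k := Fps (fun n => (n == 1%N)%:R).

Lemma fpsXnM n f j : fpsc (fpsX ^+ n * f) j = if (j < n)%N then 0 else fpsc f (j - n).
Proof.
elim: n j => [|n IH] j; first by rewrite expr0 mul1r subn0.
rewrite exprS -mulrA [LHS]/= big_ord_recl mul0r add0r.
case: j => [|j]; first by rewrite big_ord0.
rewrite big_ord_recl [X in X + _]/= mul1r subn1 [X in X + _]IH ltnS subSS big1 ?addr0 // => i _.
by rewrite mul0r.
Qed.

Lemma fps_neq0 f : f != 0 -> exists n u, fps_unit u /\ f = fpsX ^+ n * u.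
Proof.
move=> f0; have ex : exists n, fpsc f n != 0.
  apply: contrapT => h; move/eqP: f0; apply; apply: fpsP => n.
  by apply/eqP; apply: contrapT => hn; apply: h; exists n; apply/negP.
case: (ex_minnP ex) => n hn hmin; exists n, (Fps (fun j => fpsc f (j + n))); split=> //.
apply: fpsP => j; rewrite fpsXnM; case: ltnP => h /=; last by rewrite subnK.
by apply/eqP; apply: contraTT h => /hmin; rewrite -leqNgt.
Qed.

Fact fps_integral f g : f * g = 0 -> (f == 0) || (g == 0).
Proof.
move=> e; apply: contrapT => /negP; rewrite negb_or => /andP[/fps_neq0[m [u [hu eu]]] /fps_neq0[n [w [hw ew]]]].
move: e => /(congr1 (fun f => fpsc f (m + n))).
rewrite eu ew mulrACA -exprD fpsXnM ltnn subnn /= big_ord1 => /eqP.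
by rewrite mulf_eq0 (negbTE hu) (negbTE hw).
Qed.

HB.instance Definition _ := GRing.ComUnitRing_isIntegral.Build (fps k) fps_integral.
End Fps.

(** * Laurent series as fractions of power series *)

Section Laurent.
Variable k : fieldType.
Notation lau := {fraction (fps k)}.
Notation emf := (@FracField.tofrac (fps k)).
Definition lauX : lau := emf (fpsX k).
Definition lau_integral (z : lau) : Prop := exists f, z = emf f.

Lemma tofrac_fps_inj : injective emf.
Proof. by move=> f g /eqP; rewrite tofrac_eq => /eqP. Qed.

Lemma lauX_neq0 : lauX != 0.
Proof.
rewrite /lauX tofrac_eq0; apply/eqP => /(congr1 (fun f => fpsc f 1)) /eqP.
by rewrite oner_eq0.
Qed.

Lemma tofrac_fpsV f : fps_unit f -> emf f^-1 = (emf f)^-1.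
Proof.
move=> hf; have u : f \is a GRing.unit by [].
by rewrite rmorphV.
Qed.

Lemma lau_frac (z : lau) : exists n d, d != 0 /\ z = emf n / emf d.
Proof.
elim/quotW: z => r; exists (\n_r), (\d_r); split; first exact: denom_ratioP.
rewrite -[emf _ / _]/(FracField.mul _ (FracField.inv _)) !piE.
by rewrite /FracField.mulf /FracField.invf !numden_Ratio ?oner_eq0 ?denom_ratioP // mulr1 mul1r Ratio_numden.
Qed.

Lemma lau_repr (z : lau) : exists (n : nat) f, z = lauX ^- n * emf f.
Proof.
have [a [b [/fps_neq0[n [u [hu ->]]] ->]]] := lau_frac z.
exists n, (a * u^-1); rewrite !rmorphM rmorphXn /= tofrac_fpsV // invfM /lauX.
by rewrite [_^-1 * _]mulrC mulrA [LHS]mulrC.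
Qed.

(** The value no longer depends on the chosen shift, so [lequiv] becomes equality in a field. *)
Definition lau_of (f : lser k) : lau := lauX ^ lshift f * emf (Fps (lps f)).

Implicit Types f g h : lser k.

Lemma lau_of_surj (z : lau) : exists f, z = lau_of f.
Proof.
have [n [[f] ->]] := lau_repr z; exists (LSer (- n%:Z) f).
by rewrite /lau_of exprnN.
Qed.

Lemma lauX_D (m n : int) : lauX ^ (m + n) = lauX ^ m * lauX ^ n.
Proof. exact: expfzDr lauX_neq0. Qed.

Lemma lau_of_shift m (f : lser k) : m <= lshift f -> lau_of f = lau_of (LSer m (fun j => coef f (m + j%:Z))).
Proof.
move=> h; have [d e] : exists d : nat, lshift f = m + d%:Z by exists `|lshift f - m|%N; lia.
rewrite /lau_of /= e lauX_D -mulrA; congr (_ * _); rewrite -exprnP -rmorphXn -rmorphM /=.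
congr emf; apply: fpsP => j; rewrite fpsXnM /= /coef e.
case: ltnP => hj.
  by have -> : m + j%:Z - (m + d%:Z) = Negz (d - j).-1 by lia.
by have -> : m + j%:Z - (m + d%:Z) = Posz (j - d)%N by lia.
Qed.

Lemma vge_lau_of N (f : lser k) : vge lauX lau_integral N (lau_of f) <-> forall n : int, n < N -> coef f n = 0.
Proof.
split=> [[g] | h].
  move=> e n hn; have {e} e : lau_of f = lauX ^ N * emf g.
    by rewrite -e mulrC -mulrA -lauX_D addNr expr0z mulr1.
  rewrite /coef; case en: (n - lshift f) => [j|//].
  have [d ed] : exists d : nat, N = lshift f + d%:Z by exists `|N - lshift f|%N; lia.
  move: e; rewrite /lau_of ed lauX_D -mulrA => /(mulfI (expfz_neq0 _ lauX_neq0)).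
  rewrite -exprnP -rmorphXn -rmorphM => /tofrac_fps_inj /(congr1 (fun p : fps k => fpsc p j)).
  by rewrite fpsXnM ifT //; lia.
pose m := Order.min N (lshift f); have mN : m <= N by rewrite ge_min lexx.
have mf : m <= lshift f by rewrite ge_min lexx orbT.
have [d ed] : exists d : nat, N = m + d%:Z by exists `|N - m|%N; lia.
exists (Fps (fun j => coef f (m + (j + d)%N%:Z))).
rewrite (lau_of_shift mf) /lau_of /= mulrAC -lauX_D ed opprD addrA subrr add0r.
apply: (mulfI (expfz_neq0 d lauX_neq0)); rewrite mulrA -lauX_D subrr expr0z mul1r.
rewrite -exprnP -rmorphXn -rmorphM; congr emf; apply: fpsP => j; rewrite fpsXnM /=.
by case: ltnP => hj; [rewrite h //; lia|rewrite subnK].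
Qed.

Lemma lau_ofB_coef (f g : lser k) : exists h, lau_of f - lau_of g = lau_of h /\ forall n, coef h n = coef f n - coef g n.
Proof.
pose m := Order.min (lshift f) (lshift g).
have mf : m <= lshift f by rewrite ge_min lexx.
have mg : m <= lshift g by rewrite ge_min lexx orbT.
exists (LSer m (fun j => coef f (m + j%:Z) - coef g (m + j%:Z))); split.
  rewrite (lau_of_shift mf) (lau_of_shift mg) /lau_of /= -mulrBr -rmorphB; congr (_ * emf _).
move=> n; rewrite {1}/coef /=; case e: (n - m) => [j|j].
  by have -> : m + j%:Z = n by lia.
have neg h : m <= lshift h -> coef h n = 0.
  move=> hm; rewrite /coef; have -> // : n - lshift h = Negz (j + `|lshift h - m|%N) by lia.
by rewrite !neg // subrr.
Qed.

Lemma vge_lau_ofB N (f g : lser k) :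
  vge lauX lau_integral N (lau_of f - lau_of g) <-> forall n : int, n < N -> coef f n = coef g n.
Proof.
have [h [-> e]] := lau_ofB_coef f g; rewrite vge_lau_of.
split=> H n /H; rewrite e; first by move/eqP; rewrite subr_eq0 => /eqP.
by move=> ->; rewrite subrr.
Qed.

Lemma lau_integral_sep (z : lau) : (forall n : nat, lau_integral (z * lauX ^- n)) -> z = 0.
Proof.
have [f ->] := lau_of_surj z => h.
have e : forall n, coef f n = 0.
  move=> n; have /vge_lau_of : vge lauX lau_integral `|(n + 1)%R|%N (lau_of f) by rewrite /vge -exprnN; apply: h.
  by apply; lia.
have := @lau_of_shift _ f (lexx _); rewrite /lau_of /= => ->.
rewrite (_ : Fps _ = 0) ?rmorph0 ?mulr0 //; apply: fpsP => j; exact: e.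
Qed.

Lemma lau_integral_complete (s : nat -> lau) :
  (forall N : int, exists M0 : nat, forall M, (M0 <= M)%N ->
     vge lauX lau_integral N (s M.+1 - s M)) ->
  exists L, tends lauX lau_integral s L.
Proof.
move=> hs.
have [l hl] : exists l : nat -> lser k, forall M, s M = lau_of (l M).
  by apply: (choice (fun M f => s M = lau_of f)) => M; apply: lau_of_surj.
have [mu hmu] : exists mu : int -> nat, forall N M, (mu N <= M)%N ->
    forall n : int, n < N -> coef (l M) n = coef (l (mu N)) n.
  apply: (choice (fun N M0 => forall M, (M0 <= M)%N -> forall n : int, n < N ->
     coef (l M) n = coef (l M0) n)) => N; have [M0 h0] := hs N; exists M0 => M /subnKC <- n hn.
  elim: (M - M0)%N => [|j IH]; first by rewrite addn0.
  have := h0 _ (leq_addr j M0); rewrite !hl => /vge_lau_ofB h.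
  by rewrite addnS h.
(* Coefficients of negative index eventually agree with those of [l (mu 0)], whose shift bounds the
   support below. The coefficient at [n] is read from [mu (n + 1)] because agreement at level [N]
   concerns [n < N] only. *)
pose b := Order.min 0 (lshift (l (mu 0))).
pose L := LSer b (fun j => coef (l (mu (b + j%:Z + 1))) (b + j%:Z)).
exists (lau_of L) => N; exists (mu N) => M hM; rewrite hl; apply/vge_lau_ofB => n hn.
rewrite (hmu N M) // {2}/coef /=; case e: (n - b) => [j|j]; last first.
  have hb0 : b <= 0 by rewrite ge_min lexx.
  have hbl : b <= lshift (l (mu 0)) by rewrite ge_min lexx orbT.
  have n0 : n < 0 by lia.
  rewrite -(hmu N (maxn (mu N) (mu 0)) (leq_maxl _ _) n hn).
  rewrite (hmu 0 _ (leq_maxr _ _) n n0) /coef.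
  move: hbl e; move: (b) (lshift _) => c d hd e.
  by have -> : n - d = Negz (j + `|(d - c)%R|%N) by lia.
have -> : b + j%:Z = n by lia.
rewrite -(hmu N (maxn (mu N) (mu (n + 1))) (leq_maxl _ _) n hn).
by rewrite (hmu (n + 1) _ (leq_maxr _ _) n _) //; lia.
Qed.

Lemma laurent_valuation_ring : complete_valuation_ring lauX lau_integral.
Proof.
split.
- exact: lauX_neq0.
- by exists 1; rewrite rmorph1.
- by exists (fpsX k).
- by move=> _ _ [f ->] [g ->]; exists (f - g); rewrite rmorphB.
- by move=> _ _ [f ->] [g ->]; exists (f * g); rewrite rmorphM.
- move=> _ [f ->]; exists (1 + fpsX k * f)^-1; rewrite tofrac_fpsV.
    by rewrite rmorphD rmorphM rmorph1.
  by rewrite /fps_unit /= big_ord1 mul0r addr0 oner_eq0.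
- exact: lau_integral_sep.
- move=> z; have [n [f ->]] := lau_repr z; exists n, f.
  by rewrite mulrAC mulVf ?mul1r // expf_neq0 // lauX_neq0.
- exact: lau_integral_complete.
Qed.
End Laurent.

Section Qbinom.
Variables (F : fieldType) (v : F) (O : F -> Prop).
Hypothesis hO : complete_valuation_ring v O.

(** The numerator runs from [i+k] down to [i-k+1]; raising [k] adds one bracket at each end. *)
Lemma qbin_ratio (k i : nat) : (k <= i)%N ->
  (\prod_(j < 2 * k) qbracket v (k + i - j)%N) / (\prod_(j < 2 * k) qbracket v j.+1) = qbin v k i.
Proof.
elim: k => [|k IH] hk; first by rewrite !big_ord0 qbin0 invr1 mulr1.
have -> : (2 * k.+1 = (2 * k).+2)%N by lia.
rewrite big_ord_recl big_ord_recr /= qbinS -(IH (ltnW hk)) !big_ord_recr /=.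
under eq_bigr => j _ do rewrite /bump add1n addSn subSS.
have -> : i%:Z + k%:Z + 1 = (k.+1 + i - 0)%N by lia.
have -> : i%:Z - k%:Z = (k.+1 + i - bump 0 (2 * k))%N by rewrite /bump; lia.
rewrite addn1 addn2; move: (\prod_(_ < _) _) (\prod_(_ < _) _) => a b.
by rewrite !invfM; ring.
Qed.
End Qbinom.

Lemma double_bin2 m : (2 * 'C(m.+1, 2) = m * m.+1)%N.
Proof. by elim: m => // m IH; rewrite binS mulnDr IH bin1; lia. Qed.

(** Rests on binom(i+1, 2) + binom(n+1, 2) + ni = binom(i+n+1, 2). *)
Lemma theta_summandE (F : fieldType) (v x : F) i n :
  gauss v i * ((-1) ^+ n.+1 * (x ^+ n.+1 + x ^- n.+1) * v ^+ (2 * ('C(n.+2, 2) + n.+1 * i))) =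
  theta_summand v x i n.
Proof.
rewrite /theta_summand /xsym /gauss mulnDr double_bin2.
have -> : ((i + n.+1) * (i + n.+1).+1 = i * i.+1 + (n.+1 * n.+2 + 2 * (n.+1 * i)))%N by lia.
rewrite !exprD; ring.
Qed.

Section Const.
Variable k : fieldType.
Definition fps_const (c : k) : fps k := Fps (fun j => if j == 0%N then c else 0).

Fact fps_const_zmod : zmod_morphism fps_const.
Proof. by move=> c d; apply: fpsP => -[|j] //=; rewrite subrr. Qed.
HB.instance Definition _ := GRing.isZmodMorphism.Build k (fps k) fps_const fps_const_zmod.

Fact fps_const_monoid : monoid_morphism fps_const.
Proof.
split; first by apply: fpsP => -[|j].
move=> c d; apply: fpsP => -[|j] /=; first by rewrite big_ord1.
by rewrite big_ord_recl /= mulr0 add0r big1 // => i _; rewrite mul0r.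
Qed.
HB.instance Definition _ := GRing.isMonoidMorphism.Build k (fps k) fps_const fps_const_monoid.

Definition lau_const (c : k) : {fraction (fps k)} := @FracField.tofrac _ (fps_const c).

Fact lau_const_zmod : zmod_morphism lau_const.
Proof. by move=> c d; rewrite /lau_const !rmorphB. Qed.
HB.instance Definition _ := GRing.isZmodMorphism.Build k {fraction (fps k)} lau_const lau_const_zmod.

Fact lau_const_monoid : monoid_morphism lau_const.
Proof. by split=> [|c d]; rewrite /lau_const ?rmorph1 ?rmorphM. Qed.
HB.instance Definition _ := GRing.isMonoidMorphism.Build k {fraction (fps k)} lau_const lau_const_monoid.
End Const.

(** * Interpretation of the concrete Laurent series *)

Local Notation v := (lauX K).
Local Notation O := (@lau_integral K).
Local Notation hO := (laurent_valuation_ring K).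

Implicit Types (c : K) (f : lser K).

Lemma vge_lau_const c : vge v O 0 (lau_const c).
Proof. by rewrite /vge oppr0 expr0z mulr1; exists (fps_const c). Qed.

Lemma lau_constV c : lau_const c^-1 = (lau_const c)^-1.
Proof. exact: fmorphV. Qed.

Lemma lau_of_mono c e : lau_of (lmono c e) = lau_const c * v ^ e.
Proof. by rewrite /lau_of mulrC. Qed.

Lemma lau_of_one : lau_of lone = 1.
Proof. by rewrite lau_of_mono rmorph1 expr0z mulr1. Qed.

Lemma lau_of_zero : lau_of lzero = 0.
Proof. by rewrite lau_of_mono rmorph0 mul0r. Qed.

Lemma lau_of_mul f g : lau_of (lmul f g) = lau_of f * lau_of g.
Proof. by rewrite /lau_of /= lauX_D mulrACA -rmorphM. Qed.

Lemma lau_of_opp f : lau_of (lopp f) = - lau_of f.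
Proof. by rewrite /lau_of /= -mulrN -rmorphN. Qed.

Lemma lau_of_add f g : lau_of (ladd f g) = lau_of f + lau_of g.
Proof.
have mf : Order.min (lshift f) (lshift g) <= lshift f by rewrite ge_min lexx.
have mg : Order.min (lshift f) (lshift g) <= lshift g by rewrite ge_min lexx orbT.
by rewrite (lau_of_shift mf) (lau_of_shift mg) /lau_of /= -mulrDr -rmorphD.
Qed.

Lemma lau_of_eqP f g : lequiv f g <-> lau_of f = lau_of g.
Proof.
split=> [h | e n].
  apply/eqP; rewrite -subr_eq0; apply/eqP/(vge_sep hO) => N.
  by apply/vge_lau_ofB => n _; apply: h.
have /vge_lau_ofB : vge v O (n + 1) (lau_of f - lau_of g) by rewrite e subrr; apply: (vge_0 hO).
by apply; lia.
Qed.

(** The chosen inverse is meaningful once some inverse exists; surjectivity of [lau_of] provides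
    one. *)
Lemma lau_of_linv f : lau_of f != 0 -> lau_of (linv f) = (lau_of f)^-1.
Proof.
move=> f0; have [g hg] := lau_of_surj (lau_of f)^-1.
have ex : exists g, lequiv (lmul f g) lone.
  by exists g; apply/lau_of_eqP; rewrite lau_of_mul -hg mulfV // lau_of_one.
have /lau_of_eqP := epsilon_spec inh_lser _ ex.
rewrite -/(linv f) lau_of_mul lau_of_one => e.
by apply: (mulfI f0); rewrite e mulfV.
Qed.

Lemma lau_of_sum s m : lau_of (lsum_fin s m) = \sum_(j < m) lau_of (s j).
Proof.
rewrite /lsum_fin -(big_mkord predT (fun j => lau_of (s j))) /index_iota subn0.
elim: (iota 0 m) => [|j r IH] /=; first by rewrite big_nil lau_of_zero.
by rewrite big_cons lau_of_add IH.
Qed.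

Lemma lau_of_prod s m : lau_of (lprod_fin s m) = \prod_(j < m) lau_of (s j).
Proof.
rewrite /lprod_fin -(big_mkord predT (fun j => lau_of (s j))) /index_iota subn0.
elim: (iota 0 m) => [|j r IH] /=; first by rewrite big_nil lau_of_one.
by rewrite big_cons lau_of_mul IH.
Qed.

Lemma has_limP s L : has_lim s L <-> tends v O (fun M => lau_of (s M)) (lau_of L).
Proof.
by split=> h N; have [M0 h0] := h N; exists M0 => M /h0 /vge_lau_ofB.
Qed.

Lemma llimP s L : tends v O (fun M => lau_of (s M)) L ->
  has_lim s (llim s) /\ lau_of (llim s) = L.
Proof.
have [l ->] := lau_of_surj L => h.
have hl : has_lim s (llim s) by apply: epsilon_spec; exists l; apply/has_limP.
by split=> //; apply: (tends_uniq hO _ h); apply/has_limP.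
Qed.

Lemma lsumP (s : nat -> lser K) L : tends v O (fun M => \sum_(j < M) lau_of (s j)) L ->
  has_sum s (lsum s) /\ lau_of (lsum s) = L.
Proof.
by move=> h; apply: (@llimP (lsum_fin s)); apply: (tends_ext _ h) => M; rewrite lau_of_sum.
Qed.

Lemma lau_of_vpow e : lau_of (vpow e) = v ^ e.
Proof. by rewrite lau_of_mono rmorph1 mul1r. Qed.

Lemma lauX_sub_neq0 : v - v ^ (-1) != 0.
Proof.
apply: contra_neq (v2_sub1_neq0 hO) => /(congr1 ( *%R v)).
by rewrite mulr0 mulrBr exprN1 mulfV // lauX_neq0.
Qed.

Lemma lau_of_vpowB m n : lau_of (ladd (vpow m) (lopp (vpow n))) = v ^ m - v ^ n.
Proof. by rewrite lau_of_add lau_of_opp !lau_of_vpow. Qed.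

Lemma lau_of_qint m : lau_of (qint m) = qbracket v m.
Proof.
rewrite /qint lau_of_mul lau_of_linv (lau_of_vpowB 1); last exact: lauX_sub_neq0.
by rewrite (lau_of_vpowB m) /qbracket; reflexivity.
Qed.

Lemma lau_of_qbinom k i : (k <= i)%N -> lau_of (qbinom (k + i) (2 * k)) = qbin v k i.
Proof.
move=> h; rewrite lau_of_mul lau_of_linv !lau_of_prod.
  rewrite -(qbin_ratio v h); congr (_ / _); apply: eq_bigr => j _; exact: lau_of_qint.
by apply/prodf_neq0 => j _; rewrite lau_of_qint (qbracket_neq0 hO).
Qed.

Lemma lau_of_qpoch a m : lau_of (qpoch a m) = qprod v (lau_of a) m.
Proof.
rewrite lau_of_prod; apply: eq_bigr => j _.
by rewrite lau_of_add lau_of_opp lau_of_mul lau_of_one lau_of_vpow.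
Qed.

Lemma vge_emb (f : lser int) b : delta_ge f b -> vge v O (2 * b) (lau_of (emb f)).
Proof.
move=> h; apply/vge_lau_of => n hn; rewrite /coef /=; case e: (n - _) => [j|//].
case: ifP => // oj.
have := h (lshift f + j./2%:Z); rewrite /coef addrAC subrr add0r => -> //.
by have := odd_double_half j; rewrite oj; lia.
Qed.

(** * Specialization to the indeterminate x and transfer of the identity *)

Local Notation x := (lau_const xK).

Lemma xK_neq0 : xK != 0.
Proof. by rewrite tofrac_eq0 polyX_eq0. Qed.

Lemma x_neq0 : x != 0.
Proof. by rewrite fmorph_eq0 xK_neq0. Qed.

Lemma x1_neq0 : 1 - x != 0.
Proof.
rewrite -(rmorph1 (@lau_const K)) -rmorphB fmorph_eq0 -tofrac1 -tofracB tofrac_eq0.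
by rewrite -opprB oppr_eq0 polyXsubC_eq0.
Qed.

Lemma vge_xV : vge v O 0 x^-1.
Proof. by rewrite -lau_constV; apply: vge_lau_const. Qed.

Lemma vge_x1V : vge v O 0 (1 - x)^-1.
Proof. by rewrite -(rmorph1 (@lau_const K)) -rmorphB -lau_constV; apply: vge_lau_const. Qed.

Lemma lau_of_qS : lau_of qS = v ^+ 2.
Proof. by rewrite lau_of_vpow. Qed.

Lemma lau_of_xS : lau_of xS = x.
Proof. by rewrite lau_of_mono expr0z mulr1. Qed.

Lemma lau_of_qxinvS : lau_of qxinvS = v ^+ 2 / x.
Proof. by rewrite lau_of_mono lau_constV mulrC. Qed.

Lemma lau_const_sign n c : lau_const ((-1) ^+ n * c) = (-1) ^+ n * lau_const c.
Proof. by rewrite rmorphM rmorphXn rmorphN1. Qed.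

Lemma lau_of_gauss k : lau_of (lmono ((-1) ^+ k) (2 * ('C(k.+1, 2))%:Z)) = gauss v k.
Proof.
rewrite lau_of_mono -[(-1) ^+ k]mulr1 lau_const_sign rmorph1 mulr1 /gauss; congr (_ * _).
by rewrite -PoszM double_bin2.
Qed.

Lemma lau_of_theta_term i n : gauss v i * lau_of (theta_term i n) = theta_summand v x i n.
Proof.
rewrite lau_of_mono lau_const_sign rmorphD rmorphXn fmorphV rmorphXn -PoszM -exprnP.
exact: theta_summandE.
Qed.

Lemma theta_termP i : has_sum (theta_term i) (lsum (theta_term i)) /\
  tends v O (fun M => gauss v i + \sum_(n < M) theta_summand v x i n) (lau_of (theta i)).
Proof.
have [S hS] : exists S, tends v O (fun M => \sum_(n < M) lau_of (theta_term i n)) S.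
  apply: (series_cvg hO (u := fun n => lau_of (theta_term i n))); apply: (@tends0_quad _ _ _ hO 0) => M.
  have -> : lau_of (theta_term i M) = theta_summand v x i M / gauss v i.
    by rewrite -lau_of_theta_term mulrC mulKf // (gauss_neq0 hO).
  apply: (vge_le hO); first apply: (vge_M hO) (vge_gaussV hO i).
    exact: (vge_theta_summand hO (vge_lau_const xK) vge_xV).
  nia.
have [h1 h2] := lsumP hS; split=> //.
rewrite /theta lau_of_mul lau_of_gauss lau_of_add lau_of_one h2.
have := tendsM hO (tends_const hO (gauss v i)) (tendsD hO (tends_const hO 1) hS).
apply: tends_ext => M; rewrite mulrDr mulr1 mulr_sumr; congr (_ + _).
by apply: eq_bigr => n _; apply: lau_of_theta_term.
Qed.

Lemma lau_of_P_term a k : lau_of (P_term a k) = lau_of (aneg a k) * habiro_term v x k.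
Proof.
have [h1 _] := qprod_unit hO k (vge_v2x hO vge_xV).
have [h2 _] := qprod_x_unit hO (vge_lau_const xK) x1_neq0 vge_x1V k.
have e : lau_of (lmul (qpoch xS k.+1) (qpoch qxinvS k)) = qprod v x k.+1 * qprod v (v ^+ 2 / x) k.
  by rewrite lau_of_mul !lau_of_qpoch lau_of_xS lau_of_qxinvS.
rewrite /P_term; move: (aneg a k) => A.
rewrite (lau_of_mul A) /sigt (lau_of_mul (lmono _ _)) (lau_of_gauss k) lau_of_linv.
  by rewrite e /habiro_term; reflexivity.
rewrite e; exact: mulf_neq0 h2 h1.
Qed.

Lemma lau_of_R_term a i :
  lau_of (R_term a i) = (\sum_(k < i.+1) qbin v k i * lau_of (aneg a k)) * lau_of (theta i).
Proof.
rewrite lau_of_mul lau_of_sum; congr (_ * _); apply: eq_bigr => k _.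
by rewrite lau_of_mul lau_of_qbinom // -ltnS.
Qed.

Lemma qpochP a : vge v O 0 (lau_of a) ->
  has_lim (qpoch a) (qpoch_inf a) /\ tends v O (qprod v (lau_of a)) (lau_of (qpoch_inf a)).
Proof.
move=> h; have [L hL] := qprod_cvg hO h.
have hL' : tends v O (fun M => lau_of (qpoch a M)) L.
  by apply: tends_ext hL => M; rewrite lau_of_qpoch.
by have [h1 ->] := llimP hL'; split.
Qed.

Theorem theorem4p4 (a : int -> lser int) :
  lower_bound_condition a ->
  has_sum (P_term a) (lsum (P_term a)) /\
  has_sum (R_term a) (lsum (R_term a)) /\
  (forall i, has_sum (theta_term i) (lsum (theta_term i))) /\
  has_lim (qpoch qS) (qpoch_inf qS) /\
  has_lim (qpoch xS) (qpoch_inf xS) /\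
  has_lim (qpoch qxinvS) (qpoch_inf qxinvS) /\
  lequiv (lsum (P_term a)) (lmul (linv theta_prod) (lsum (R_term a))).
Proof.
move=> [C hC].
have ha k : vge v O (2 * C - (k%:Z * k%:Z - k%:Z - 2)) (lau_of (aneg a k)).
  have := vge_emb (hC (- k.+1%:Z) isT); congr (vge _ _ _ _).
  (* At n = -(k+1), n(n+3) = (k+1)(k-2) is even, so [divz] is exact and doubling returns k^2 - k -
     2. *)
  have ev : (2 %| k.+1%:Z * (k%:Z - 2))%Z by rewrite dvdzE /= abszM dvdn2 oddM; lia.
  have -> : - k.+1%:Z * (- k.+1%:Z + 3) = k.+1%:Z * (k%:Z - 2) by lia.
  have := divzK ev; lia.
have [hq limq] : has_lim (qpoch qS) (qpoch_inf qS) /\ tends v O (qprod v (v ^+ 2)) (lau_of (qpoch_inf qS)).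
  by rewrite -lau_of_qS; apply: qpochP; rewrite lau_of_qS; apply: (vge_vX hO).
have [hx limx] : has_lim (qpoch xS) (qpoch_inf xS) /\ tends v O (qprod v x) (lau_of (qpoch_inf xS)).
  by rewrite -lau_of_xS; apply: qpochP; rewrite lau_of_xS; apply: vge_lau_const.
have [hy limy] : has_lim (qpoch qxinvS) (qpoch_inf qxinvS) /\
    tends v O (qprod v (v ^+ 2 / x)) (lau_of (qpoch_inf qxinvS)).
  rewrite -lau_of_qxinvS; apply: qpochP; rewrite lau_of_qxinvS.
  by apply: (vge_le hO (vge_v2x hO vge_xV)).
have [A [B [hA hB hAB]]] := inverted_habiro hO x_neq0 (vge_lau_const xK) vge_xV x1_neq0 vge_x1V
  (fun i => (theta_termP i).2) ha.
have [hP eP] : has_sum (P_term a) (lsum (P_term a)) /\ lau_of (lsum (P_term a)) = A.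
  by apply: lsumP; apply: tends_ext hA => M; apply: eq_bigr => k _; rewrite lau_of_P_term.
have [hR eR] : has_sum (R_term a) (lsum (R_term a)) /\ lau_of (lsum (R_term a)) = B.
  by apply: lsumP; apply: tends_ext hB => M; apply: eq_bigr => i _; rewrite lau_of_R_term.
split=> //; split=> //; split; first by move=> i; have [] := theta_termP i.
split=> //; split=> //; split=> //.
have T0 := theta_product_neq0 hO (vge_lau_const xK) vge_xV x1_neq0 vge_x1V limq limx limy.
have eT : lau_of theta_prod = lau_of (qpoch_inf qS) * lau_of (qpoch_inf xS) * lau_of (qpoch_inf qxinvS).
  by rewrite /theta_prod !lau_of_mul; reflexivity.
apply/lau_of_eqP; rewrite (lau_of_mul (linv theta_prod)) eP eR (hAB _ _ _ limq limx limy) lau_of_linv eT //.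
Qed.
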